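(* Let $G$ be a finite abelian group and let $X=\mathrm{Cay}(G;S)$ be a connected abelian Cayley graph of valency $4$. Then $X$ is unstable if and only if either $X$ is bipartite, or, up to a group isomorphism (i.e. up to an isomorphism of groups carrying one connection set to the other), $X$ is one of the following: (1) $\mathrm{Cay}(G;\pm a,\pm b)$, where $|\langle a\rangle\cap\langle b\rangle|=4$; (2) $\mathrm{Cay}(G;\pm a,\pm b)$, where, for some integers $m,k\ge 1$ and $\ell$, we have $|G:\langle b\rangle|=m$, $ma=2\ell m b$, $|b|=2km$, and $4\ell^2\equiv\pm1\pmod{k}$; (3) $\mathrm{Cay}(G;\pm a,\pm b)$, where $2a=2b$; (4) $\mathrm{Cay}\bigl(\mathbb{Z}_{2n}\times\mathbb{Z}_2;\pm(1,0),(n,0),(0,1)\bigr)\cong M_{2n}\,\square\,K_2$ for some $n$; where, if $n=2$, this graph is isomorphic to $K_4\,\square\,K_2$ and can also be realized as $\mathrm{Cay}\bigl(\mathbb{Z}_2\times\mathbb{Z}_2\times\mathbb{Z}_2;(1,0,0),(0,1,0),(1,1,0),(0,0,1)\bigr)$ (this realization is also included in the list).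
   Context: All graphs are simple. For a subset $S$ of an additive abelian group $G$ with $S=-S$ and $0\notin S$, the abelian Cayley graph $\mathrm{Cay}(G;S)$ has vertex set $G$, with $g$ and $h$ adjacent if and only if $g=h+s$ for some $s\in S$. We write $\mathrm{Cay}(G;\pm a,\pm b)$ for $\mathrm{Cay}(G;\{a,-a,b,-b\})$, and similarly for other lists of generators. $|b|$ denotes the order of the element $b$. $M_{2n}=\mathrm{Cay}(\mathbb{Z}_{2n};\pm1,n)$ is the Moebius ladder with $2n$ vertices, and $\square$ is the Cartesian product of graphs. The canonical bipartite double cover of a graph $X$ is the graph $BX$ with vertex set $V(X)\times\{0,1\}$ in which $(v,0)$ is adjacent to $(w,1)$ if and only if $v$ is adjacent to $w$ in $X$ (and there are no other edges). The group $\mathrm{Aut}\,X\times S_2$, where $S_2$ is the symmetric group on $\{0,1\}$, is naturally a subgroup of $\mathrm{Aut}\,BX$. The graph $X$ is stable if $\mathrm{Aut}\,BX=\mathrm{Aut}\,X\times S_2$, and unstable otherwise. *)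

(* Defs.v *)
From HB Require Import structures.
From mathcomp Require Import all_boot all_order all_fingroup all_algebra.

Set Implicit Arguments.
Unset Strict Implicit.
Unset Printing Implicit Defensive.

Import GRing.Theory.
Local Open Scope ring_scope.

(* A graph is an adjacency relation [e : rel V] on a finite vertex type; the
   relations below are symmetric and irreflexive whenever their arguments
   are (for [cay S]: whenever S = -S and 0 is not in S). *)

Definition cay (G : finZmodType) (S : {set G}) : rel G :=
  fun g h => [exists s in S, g == h + s].

Definition connected (V : finType) (e : rel V) : Prop :=
  forall x y, connect e x y.

Definition regular_of_valency (V : finType) (d : nat) (e : rel V) : Prop :=
  forall x, #|[set y | e x y]| = d.

Definition bipartite (V : finType) (e : rel V) : Prop :=
  exists c : V -> bool, forall x y, e x y -> c x != c y.

Definition graph_iso (V W : finType) (e : rel V) (f : rel W) : Prop :=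
  exists2 phi : V -> W, bijective phi & forall x y, f (phi x) (phi y) = e x y.

Definition graph_aut (V : finType) (e : rel V) : {set {perm V}} :=
  [set s : {perm V} | [forall x, forall y, e (s x) (s y) == e x y]].

(* Canonical bipartite double cover; {0,1} is represented by [bool]. *)
Definition double_cover (V : finType) (e : rel V) : rel (V * bool) :=
  fun p q => (p.2 != q.2) && e p.1 q.1.

Definition prod_fun (V W : finType) (s : {perm V}) (t : {perm W})
  (p : V * W) : V * W := (s p.1, t p.2).

Lemma prod_fun_inj (V W : finType) (s : {perm V}) (t : {perm W}) :
  injective (prod_fun s t).
Proof. by move=> [x i] [y j] [/perm_inj -> /perm_inj ->]. Qed.

Definition prod_perm (V W : finType) (s : {perm V}) (t : {perm W}) :
  {perm V * W} := perm (@prod_fun_inj V W s t).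

(* Aut BX = Aut X x S_2, with Aut X x S_2 acting coordinatewise. *)
Definition stable (V : finType) (e : rel V) : Prop :=
  graph_aut (double_cover e) =
  [set prod_perm s t | s in graph_aut e, t in [set: {perm bool}]].

Definition unstable (V : finType) (e : rel V) : Prop := ~ stable e.

Definition cartesian (V W : finType) (e : rel V) (f : rel W) : rel (V * W) :=
  fun p q => (p.1 == q.1) && f p.2 q.2 || (p.2 == q.2) && e p.1 q.1.

Definition complete (n : nat) : rel 'I_n := fun i j => i != j.
Arguments complete : clear implicits.

(* Since 'Z_0 and 'Z_1 both denote Z/2, this is only meant for 0 < n. *)
Definition moebius_ladder (n : nat) : rel 'Z_(2 * n) :=
  cay [set 1; -1; n%:R].
Arguments moebius_ladder : clear implicits.

(* An isomorphism of groups carrying one connection set to the other. *)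
Definition cay_group_iso (G H : finZmodType) (S : {set G}) (T : {set H}) :
  Prop :=
  exists f : {additive G -> H}, bijective f /\ f @: S = T.

Definition pm2 (G : finZmodType) (a b : G) : {set G} := [set a; - a; b; - b].

Definition family1 (G : finZmodType) (a b : G) : Prop :=
  #|(<[a]> :&: <[b]>)%g| = 4%N.

Definition family2 (G : finZmodType) (a b : G) : Prop :=
  exists (m k : nat) (l : int),
    [/\ (1 <= m)%N /\ (1 <= k)%N,
        #|[set: G] : <[b]>|%g = m,
        a *+ m = b *~ (2 * l * m%:Z),
        #[b]%g = (2 * k * m)%N
      & (4 * l ^+ 2 = 1 %[mod k%:Z])%Z \/ (4 * l ^+ 2 = -1 %[mod k%:Z])%Z].

Definition family3 (G : finZmodType) (a b : G) : Prop := a *+ 2 = b *+ 2.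

(* Gives products of [finZmodType]s their [finZmodType] structure, which the
   library does not declare. *)
HB.saturate prod.

(* As for [moebius_ladder], meant for 0 < n. *)
Definition ladder_group (n : nat) : finZmodType := ('Z_(2 * n) * 'Z_2)%type.

Definition family4_set (n : nat) : {set ladder_group n} :=
  [set (1, 0); - (1, 0); (n%:R, 0); (0, 1)].

Definition cube_group : finZmodType := ('Z_2 * 'Z_2 * 'Z_2)%type.

Definition family4_cube_set : {set cube_group} :=
  [set (1, 0, 0); (0, 1, 0); (1, 1, 0); (0, 0, 1)].

(* Main.v *)
Require Import Defs.
From HB Require Import structures.
From mathcomp Require Import all_boot all_order all_fingroup all_algebra.
From mathcomp Require Import cyclic ring zify.

Set Implicit Arguments.
Unset Strict Implicit.
Unset Printing Implicit Defensive.

Import GRing.Theory FinRing.Theory.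
Local Open Scope ring_scope.

(** Two-fold automorphisms, i.e. pairs of permutations (f, g) with
    f x - g y in S <-> x - y in S, are the automorphisms of BX that preserve the
    two colour classes; for connected non-bipartite X, instability means that
    there is one with f <> g.

    Suppose S = {a, -a, b, -b}, and a, b satisfy no relation i a + j b = 0 with
    i + j even and 0 < |i| + |j| <= 4.  Then BX has no 4-cycles besides those of
    the square grid, so an automorphism of BX displaces the edges in the same
    way at all vertices.  Hence, after normalisation, f is a group automorphism
    and g = f + w with 2 w = 0, so f(S) = S + w.  Such an f either maps a to
    +-a + w and b to +-b + w, which leads to (1), or exchanges the roles of a
    and b, which leads to (2).

    When there are short relations, the number of common neighbours mod 2 is
    used: it is odd exactly at the differences having an odd number of halves
    in S.  For S = {t, -t, u, u + z} with 2 z = 0 this singles out the t-edges,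
    and walking an odd multiple of t equal to 0 or z gives f = g.  In odd order
    it shows that f preserves the dilates 2 S, 4 S, ..., hence S itself.

    Conversely, in families (1), (2) and (4) one writes down f and w with
    f(S) = S + w, and in family (3) S is invariant under translation by a - b. *)

(* The square-zero extension of the integers by a Z-module is a commutative
   ring, so that [ring] decides identities of abelian groups. *)
Section SquareZero.
Variable G : zmodType.
Definition sqz : Type := (int * G)%type.
HB.instance Definition _ := GRing.Zmodule.copy sqz (int * G)%type.
Implicit Types x y z : sqz.

Definition sqz_mul x y : sqz := (x.1 * y.1, y.2 *~ x.1 + x.2 *~ y.1).

Lemma sqz_mulC : commutative sqz_mul.
Proof. by move=> x y; rewrite /sqz_mul mulrC addrC. Qed.

Lemma sqz_mulA : associative sqz_mul.
Proof.
move=> x y z; congr (_, _) => /=; first by rewrite mulrA.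
by rewrite !mulrzDl_tmp !mulrzA addrA -!mulrzA [z.1 * x.1]mulrC [y.1 * x.1]mulrC.
Qed.

Lemma sqz_mul1 : left_id ((1, 0) : sqz) sqz_mul.
Proof. by move=> [n g]; rewrite /sqz_mul /= mul1r mul0rz addr0. Qed.

Lemma sqz_mulD : left_distributive sqz_mul +%R.
Proof.
move=> x y z; congr (_, _) => /=; first by rewrite mulrDl.
by rewrite mulrzDr_tmp mulrzDl_tmp addrACA.
Qed.

Lemma sqz_oner_neq0 : ((1, 0) : sqz) != 0. Proof. by []. Qed.

HB.instance Definition _ := GRing.Zmodule_isComNzRing.Build sqz
  sqz_mulA sqz_mulC sqz_mul1 sqz_mulD sqz_oner_neq0.

Definition sqz_in (g : G) : sqz := (0, g).

Lemma sqz_in_additive : zmod_morphism sqz_in.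
Proof. by move=> g h; congr (_, _). Qed.

HB.instance Definition _ :=
  GRing.isZmodMorphism.Build G sqz sqz_in sqz_in_additive.

Lemma sqz_in_inj : injective sqz_in.
Proof. by move=> g h []. Qed.
End SquareZero.

Ltac zmod := apply: sqz_in_inj; ring.

Section LinearCombination.
Variable G : zmodType.
Implicit Types x y l r : G.

(** To prove x = y, the difference x - y is displayed as an integer combination of the differences l
    - r of known equations. The coefficients are given by hand and [zmod] checks the resulting
    identity. *)
Lemma zeq l r x y : l = r -> x - y = l - r -> x = y.
Proof. by move=> -> /eqP; rewrite subrr subr_eq0 => /eqP. Qed.

Lemma zeqz (c : int) l r x y : l = r -> x - y = (l - r) *~ c -> x = y.
Proof. by move=> -> /eqP; rewrite subrr mul0rz subr_eq0 => /eqP. Qed.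

Lemma zeqz2 (c d : int) l r l' r' x y :
  l = r -> l' = r' -> x - y = (l - r) *~ c + (l' - r') *~ d -> x = y.
Proof.
by move=> -> -> /eqP; rewrite !subrr !mul0rz addr0 subr_eq0 => /eqP.
Qed.

Lemma zeqz3 (c d e : int) l r l' r' l'' r'' x y :
  l = r -> l' = r' -> l'' = r'' ->
  x - y = (l - r) *~ c + (l' - r') *~ d + (l'' - r'') *~ e -> x = y.
Proof.
by move=> -> -> -> /eqP; rewrite !subrr !mul0rz !addr0 subr_eq0 => /eqP.
Qed.
End LinearCombination.
Arguments zeqz {G} c {l r x y}.
Arguments zeqz2 {G} c d {l r l' r' x y}.
Arguments zeqz3 {G} c d e {l r l' r' l'' r'' x y}.

(** * Two-fold automorphisms *)

Section TwoFold.
Variable V : finType.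
Implicit Types (e : rel V) (a b : V -> V).

Definition twofold e a b :=
  [/\ injective a, injective b & forall x y, e (a x) (b y) = e x y].

Definition nontrivial_twofold e := exists a b, twofold e a b /\ exists x, a x != b x.

Lemma twofold_sym e a b : symmetric e -> twofold e a b -> twofold e b a.
Proof. by move=> se [ia ib ab]; split=> // x y; rewrite se ab se. Qed.

Lemma prod_perm_double_cover e (s : {perm V}) (t : {perm bool}) :
  s \in graph_aut e -> prod_perm s t \in graph_aut (double_cover e).
Proof.
rewrite !inE => /forallP es; apply/forallP=> x; apply/forallP=> y.
rewrite !permE /double_cover /= (inj_eq perm_inj).
by have /forallP/(_ y.1)/eqP-> := es x.1.
Qed.

(** Letting [a] act on one layer and [b] on the other gives an automorphism of the double cover,
    whereas a product permutation moves the first coordinate in the same way on both layers. *)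
Lemma nontrivial_twofold_unstable e : symmetric e ->
  nontrivial_twofold e -> unstable e.
Proof.
move=> se [a [b [[ia ib ab] [x0 nab]]]] st.
pose f (p : V * bool) := (if p.2 then b p.1 else a p.1, p.2).
have fI : injective f by move=> [x []] [y []] [] // => [/ib|/ia] ->.
have : perm fI \in graph_aut (double_cover e).
  rewrite inE; apply/forallP=> -[x i]; apply/forallP=> -[y j].
  rewrite !permE /double_cover /f /=.
  by case: i j => [] [] //=; rewrite ?ab // se ab se.
rewrite st => /imset2P[s t _ _ E]; case/eqP: nab.
have := congr1 (fun p : {perm _} => p (x0, false)) E.
have := congr1 (fun p : {perm _} => p (x0, true)) E.
by rewrite !permE /f /prod_fun /= => -[-> _] [-> _].
Qed.

Lemma unstable_nontrivial_twofold e : symmetric e -> connected e ->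
  ~ bipartite e -> unstable e -> nontrivial_twofold e.
Proof.
move=> se ce nbip un.
have /subsetPn[phi]: ~~ (graph_aut (double_cover e) \subset
    [set prod_perm s t | s in graph_aut e, t in [set: {perm bool}]]).
  apply/negP=> sub; apply: un; apply/eqP; rewrite eqEsubset sub /=.
  by apply/subsetP=> _ /imset2P[s t s_in _ ->]; apply: prod_perm_double_cover.
rewrite inE => /forallP ephi nphi.
have {}ephi p q : double_cover e (phi p) (phi q) = double_cover e p q.
  by have /forallP/(_ q)/eqP := ephi p.
(* [c x] and [d x] are the layers of the images of (x, false) and (x, true). Across an edge they are
   opposite, so [c x (+) d x] is constant; if it were false, [c] would be a proper 2-colouring.
   Hence [c] is constant and [phi] preserves or exchanges the layers. *)
pose c x := (phi (x, false)).2; pose d x := (phi (x, true)).2.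
have cd x y : e x y -> c x = ~~ d y.
  move=> exy; have : double_cover e (phi (x, false)) (phi (y, true)).
    by rewrite ephi.
  by case/andP; rewrite /c /d; do 2!case: (phi _).2.
have eq_conn (T : eqType) (h : V -> T) :
    (forall x y, e x y -> h x = h y) -> forall x y, h x = h y.
  move=> eh x y; have /connectP[p + ->] := ce x y.
  by elim: p x => //= z p IHp x /andP[/eh-> /IHp].
have dc x y : c x (+) d x = c y (+) d y.
  apply: (eq_conn _ (fun z => c z (+) d z)) => {}x {}y exy.
  rewrite (cd _ _ exy) -(negbK (d x)) -(cd y x) 1?se //.
  by case: (c y) (d y) => [] [].
have cdx x : d x = ~~ c x.
  apply/eqP; case: eqP => // /eqP cx; exfalso; apply: nbip; exists c => y z yz.
  have := dc x z; have := cd _ _ yz; move: cx.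
  by case: (c x) (d x) (c y) (d y) (c z) (d z) => [] [] [] [] [] [].
have cc x y : c x = c y by apply: (eq_conn _ c) => {}x {}y /cd; rewrite cdx negbK.
have [x0|V0] := pickP V; last first.
  have E : phi = prod_perm 1%g 1%g by apply/permP=> -[x]; have := V0 x.
  case/negP: nphi; rewrite E; apply: imset2_f; rewrite inE //.
  by apply/forallP=> x; have := V0 x.
pose a x := (phi (x, false)).1; pose b x := (phi (x, true)).1.
have phi0 x : phi (x, false) = (a x, c x0).
  by rewrite (cc x0 x) /a /c; case: (phi _).
have phi1 x : phi (x, true) = (b x, ~~ c x0).
  by rewrite (cc x0 x) -cdx /b /d; case: (phi _).
have ia : injective a.
  move=> x y axy; suff: (x, false) = (y, false) by case.
  by apply: (@perm_inj _ phi); rewrite !phi0 axy.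
have ib : injective b.
  move=> x y axy; suff: (x, true) = (y, true) by case.
  by apply: (@perm_inj _ phi); rewrite !phi1 axy.
have ab x y : e (a x) (b y) = e x y.
  have := ephi (x, false) (y, true).
  by rewrite phi0 phi1 /double_cover /=; case: (c x0).
exists a, b; split=> //; apply/existsP; apply: contraR nphi => /existsPn nab.
have {}nab x : a x = b x by apply/eqP; rewrite -[_ == _]negbK nab.
pose t := if c x0 then tperm true false else 1%g.
have -> : phi = prod_perm (perm ia) t; last first.
  apply: imset2_f; rewrite inE //.
  by apply/forallP=> x; apply/forallP=> y; rewrite !permE (nab y) ab.
apply/permP=> -[x []]; rewrite ?phi0 ?phi1 permE /prod_fun /= permE ?nab /t.
  by case: (c x0); rewrite ?tpermL ?perm1.
by case: (c x0); rewrite ?tpermR ?perm1.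
Qed.
End TwoFold.

(** * Walks, bipartiteness and affine two-fold automorphisms in Cayley graphs *)

Section Cayley.
Variables (G : finZmodType) (S : {set G}).
Hypothesis SN : S = [set - s | s in S].

Lemma cayE (T : {set G}) g h : cay T g h = (g - h \in T).
Proof.
apply/existsP/idP=> [[s /andP[sT /eqP->]]|ghT]; first by rewrite addrC addKr.
by exists (g - h); rewrite ghT subrKC /=.
Qed.

Lemma memN s : (- s \in S) = (s \in S).
Proof.
rewrite {1}SN; apply/imsetP/idP=> [[t tS /oppr_inj->] //|sS]; by exists s.
Qed.

Lemma cay_sym : symmetric (cay S).
Proof. by move=> x y; rewrite !cayE -memN opprB. Qed.

Lemma regular_card : regular_of_valency 4 (cay S) -> #|S| = 4%N.
Proof.
move=> /(_ 0) <-; apply: eq_card => s.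
by rewrite inE cayE sub0r memN.
Qed.

(** For S = -S this means that S generates the group. Words are used because the parity of their
    length matters later. *)
Definition spans := forall x, exists2 w : seq G, all (mem S) w & x = \sum_(s <- w) s.

Lemma connected_spans : connected (cay S) -> spans.
Proof.
move=> conn x; have /connectP[p] := conn 0 x.
suff /(_ 0 p) W y q : path (cay S) y q ->
    exists2 w : seq G, all (mem S) w & last y q - y = \sum_(s <- w) s.
  by move=> /W[w wS E] ->; exists w; rewrite // -E subr0.
elim: q y => [|z q IHq] y /=.
  by move=> _; exists [::]; rewrite ?big_nil ?subrr.
case/andP=> yz /IHq[w wS E]; exists (z - y :: w).
  by rewrite /= wS andbT; rewrite -memN opprB -cayE.
by rewrite big_cons -E; zmod.
Qed.

(** Choose a word [wd x] for each x. If the parity of its length changed along every edge it would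
    be a 2-colouring. So some edge yields two words of opposite parity with the same sum; one
    followed by the negative of the other is an odd relation. *)
Lemma odd_relation : spans -> ~ bipartite (cay S) ->
  exists w : seq G, [/\ all (mem S) w, odd (size w) & \sum_(s <- w) s = 0].
Proof.
move=> sp nbip.
have catP (w v : seq G) : all (mem S) w -> all (mem S) v ->
    \sum_(s <- w) s = \sum_(s <- v) s -> odd (size w) != odd (size v) ->
  exists w : seq G, [/\ all (mem S) w, odd (size w) & \sum_(s <- w) s = 0].
  move=> wS vS E o; exists (w ++ map -%R v); split.
  - rewrite all_cat wS all_map /=; apply/allP=> s /(allP vS) /=.
    by rewrite memN.
  - by rewrite size_cat size_map oddD; move: o; do 2!case: odd.
  by rewrite big_cat big_map /= sumrN E subrr.
have sp' x : exists w : seq G, all (mem S) w && (x == \sum_(s <- w) s).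
  by have [w wS ->] := sp x; exists w; rewrite wS eqxx.
pose wd x := xchoose (sp' x).
have wdS x : all (mem S) (wd x) by case/andP: (xchooseP (sp' x)).
have wdE x : x = \sum_(s <- wd x) s by apply/eqP; case/andP: (xchooseP (sp' x)).
have [/existsP[x /existsP[y /andP[xy oxy]]]|] :=
  boolP [exists x, exists y, cay S x y && (odd (size (wd x)) == odd (size (wd y)))].
  apply: (catP (wd x) (x - y :: wd y)); rewrite //= ?wdS ?andbT -?cayE //.
    by rewrite big_cons -!wdE subrK.
  by rewrite (eqP oxy); case: odd.
move/existsPn=> H; case: nbip; exists (fun x => odd (size (wd x))) => x y xy.
by have /existsPn/(_ y) := H x; rewrite xy.
Qed.

(** The double cover of a bipartite graph has no edges between the half where [p.2 == c p.1] and its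
    complement. Translating by s and switching layers on the first half only is an automorphism; it
    switches the layer at (0, c 0) but not at (s, c 0), so it is not a product. *)
Lemma bipartite_unstable s : s \in S -> bipartite (cay S) -> unstable (cay S).
Proof.
move=> sS [c cP] st.
have cs x : c (x + s) = ~~ c x.
  have /cP : cay S (x + s) x by rewrite cayE addrAC subrr add0r.
  by case: (c _) (c x) => [] [].
pose f (p : G * bool) := if p.2 == c p.1 then (p.1 + s, ~~ p.2) else p.
have fE p : ((f p).2 == c (f p).1) = (p.2 == c p.1).
  by rewrite /f; case: ifP => //= /eqP->; rewrite cs eqxx.
have fI : injective f.
  move=> p q E; have := fE p; rewrite E fE; move: E; rewrite /f.
  case: p q => [x i] [y j] /=.
  by case: ifP => _; case: ifP => // _ [/addIr-> /negb_inj->].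
have adj p q : double_cover (cay S) p q -> (p.2 == c p.1) = (q.2 == c q.1).
  case: p q => [x i] [y j] /andP[/= + /cP].
  by case: i j (c x) (c y) => [] [] [] [].
have : perm fI \in graph_aut (double_cover (cay S)).
  rewrite inE; apply/forallP=> p; apply/forallP=> q; apply/eqP; rewrite !permE.
  have [pq|pq] := eqVneq (p.2 == c p.1) (q.2 == c q.1); last first.
    by apply/idP/idP => /adj E; case/eqP: pq; move: E; rewrite ?(fE p) ?(fE q).
  rewrite /f pq; case: ifP => // _; rewrite /double_cover /= !cayE.
  rewrite (inj_eq negb_inj); congr (_ && (_ \in S)); zmod.
rewrite st => /imset2P[p q _ _ E].
have := congr1 (fun r : {perm _} => r (0, c 0)) E.
have := congr1 (fun r : {perm _} => r (s, c 0)) E.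
have cs0 : c s = ~~ c 0 by rewrite -cs add0r.
rewrite !permE /f /prod_fun /= eqxx cs0.
by case: (c 0) => /= -[_ <-] [].
Qed.

(** The pair is f and f + w: f x - f y - w is in S exactly when f (x - y) is in S + w = f(S). *)
Lemma affine_twofold (f : {additive G -> G}) w : injective f -> w != 0 ->
  f @: S = [set s + w | s in S] -> nontrivial_twofold (cay S).
Proof.
move=> fI w0 fS; exists f, (fun x => f x + w); split; last first.
  by exists 0; rewrite raddf0 add0r eq_sym.
split=> // [|x y]; first by move=> x y /addIr/fI.
rewrite !cayE opprD addrA -raddfB -(mem_imset _ _ (addIr w)) subrK -fS.
by rewrite mem_imset.
Qed.

End Cayley.

(** * Transport along isomorphisms and extension of homomorphisms *)

Lemma nontrivial_twofold_iso (V W : finType) (e : rel V) (f : rel W) :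
  graph_iso e f -> nontrivial_twofold f -> nontrivial_twofold e.
Proof.
move=> [phi [psi phiK psiK] phiE] [a [b [[ia ib ab] [x nab]]]].
exists (psi \o a \o phi), (psi \o b \o phi); split; last first.
  by exists (psi x); rewrite /= psiK (can_eq psiK).
have phiI := can_inj phiK; have psiI := can_inj psiK.
split=> [y z /psiI/ia/phiI|y z /psiI/ib/phiI|y z] //=.
by rewrite -phiE !psiK ab phiE.
Qed.

Section CayleyIso.
Variables (G H : finZmodType) (S : {set G}) (T : {set H}).

Lemma cay_group_iso_graph : cay_group_iso S T -> graph_iso (cay S) (cay T).
Proof.
move=> [f [fb fS]]; exists f => // x y.
by rewrite !cayE -fS -raddfB mem_imset //; apply: bij_inj.
Qed.

Lemma cay_group_iso_sym : cay_group_iso S T -> cay_group_iso T S.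
Proof.
move=> [f [[g fK gK] fS]].
have ga : zmod_morphism g.
  by move=> x y; apply: (can_inj fK); rewrite raddfB !gK.
pose gA := GRing.isZmodMorphism.Build H G g ga.
exists (HB.pack g gA : {additive H -> G}); split; first by exists f.
rewrite -fS -imset_comp /= -[RHS]imset_id; apply: eq_imset => x /=.
exact: fK.
Qed.

Lemma cay_group_iso_connected : cay_group_iso S T ->
  S = [set - s | s in S] -> connected (cay S) -> spans T.
Proof.
move=> [f [[g fK gK] fS]] SN /(connected_spans SN) sp y.
have [w wS E] := sp (g y); exists (map f w).
  by rewrite all_map; apply/allP=> s /(allP wS) sS; rewrite /= -fS imset_f.
by rewrite big_map -raddf_sum -E gK.
Qed.

End CayleyIso.

Lemma bipartite_iso (V W : finType) (e : rel V) (f : rel W) :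
  graph_iso e f -> bipartite f -> bipartite e.
Proof. by move=> [phi _ E] [c cP]; exists (c \o phi) => x y; rewrite -E => /cP. Qed.

(** The value at x is computed from chosen coordinates of x; the hypothesis on relations makes it
    independent of the choice. *)
Lemma extend_additive (G H : zmodType) (a b : G) (a' b' : H) :
  (forall x : G, exists ij : int * int, x == a *~ ij.1 + b *~ ij.2) ->
  (forall i j : int, a *~ i + b *~ j = 0 -> a' *~ i + b' *~ j = 0) ->
  exists f : {additive G -> H},
    forall i j : int, f (a *~ i + b *~ j) = a' *~ i + b' *~ j.
Proof.
move=> sp rel.
pose c x := xchoose (sp x).
have cE x : x = a *~ (c x).1 + b *~ (c x).2.
  by apply/eqP; apply: (xchooseP (sp x)).
pose f x := a' *~ (c x).1 + b' *~ (c x).2.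
have fE i j : f (a *~ i + b *~ j) = a' *~ i + b' *~ j.
  set x := a *~ i + b *~ j; have xE : x = a *~ i + b *~ j by [].
  have := rel ((c x).1 - i) ((c x).2 - j).
  have E0 : a *~ ((c x).1 - i) + b *~ ((c x).2 - j) = 0.
    by apply: (zeqz2 1 (-1) xE (cE x)); zmod.
  by move=> /(_ E0) E; apply: (zeq E); rewrite /f; zmod.
have fA : zmod_morphism f.
  move=> x y; rewrite {1}(cE x) {1}(cE y).
  have -> : a *~ (c x).1 + b *~ (c x).2 - (a *~ (c y).1 + b *~ (c y).2) =
    a *~ ((c x).1 - (c y).1) + b *~ ((c x).2 - (c y).2) by zmod.
  by rewrite fE /f; zmod.
pose fA' := GRing.isZmodMorphism.Build G H f fA.
by exists (HB.pack f fA' : {additive G -> H}).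
Qed.

Lemma odd_card_involution (T : finType) (A : {set T}) (f : T -> T) :
  {in A, forall x, f x \in A} -> {in A, forall x, f (f x) = x} ->
  odd #|A| = odd #|[set x in A | f x == x]|.
Proof.
have [n] := ubnP #|A|; elim: n A => // n IHn A ltAn fA fK.
have [/existsP[x /andP[xA fx]]|/existsPn fix_all] :=
  boolP [exists x, (x \in A) && (f x != x)]; last first.
  congr (odd _); apply: eq_card => x; rewrite inE.
  by have := fix_all x; case: (x \in A) => //=; rewrite negbK => ->.
have fxA : f x \in A :\ x by rewrite !inE fx fA.
have cA : #|A| = #|A :\ x :\ f x|.+2.
  by rewrite (cardsD1 x A) xA (cardsD1 (f x)) fxA.
have out : {in A :\ x :\ f x, forall y, f y \in A :\ x :\ f x}.
  move=> y; rewrite !inE => /and3P[yfx yx yA]; rewrite fA // andbT.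
  apply/andP; split; last by apply: contraNneq yfx => <-; rewrite fK.
  by apply: contraNneq yx => E; rewrite -(fK y yA) E fK.
have ltn : (#|A :\ x :\ f x| < n)%N by rewrite cA in ltAn; apply: ltnW.
rewrite cA /= negbK (IHn _ ltn out) => [|y]; last first.
  by rewrite !inE => /and3P[_ _ /fK].
congr (odd _); apply: eq_card => y; rewrite !inE.
case: (y =P x) => [->|_]; first by rewrite (negPf fx) !andbF.
case: (y =P f x) => [->|_] /=; last by [].
by rewrite fK // eq_sym (negPf fx) andbF.
Qed.

(** * Parity of the number of common neighbours *)

Section Parity.
Variables (G : finZmodType) (S : {set G}).
Hypothesis SN : S = [set - s | s in S].

Definition halves_parity (T : {set G}) (d : G) := odd #|[set s in T | s + s == d]|.

(* The number of 2-walks with difference [d] is the number of [s] with both [s]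
   and [d - s] in [S]; only the fixed points of [s |-> d - s] matter mod 2. *)
Lemma common_parity x y :
  odd #|[set v | (x - v \in S) && (y - v \in S)]| = halves_parity S (x - y).
Proof.
rewrite (odd_card_involution (f := fun v => x + y - v)); first last.
- by move=> v _; zmod.
- move=> v; rewrite !inE => /andP[xv yv].
  rewrite (_ : x - _ = - (y - v)) ?(memN SN) ?yv; last by zmod.
  by rewrite (_ : y - _ = - (x - v)) ?(memN SN) ?xv //; zmod.
rewrite /halves_parity -(card_imset _ (subrI x)); congr (odd _); apply: eq_card => s.
rewrite !inE; apply/andP/imsetP => [[/andP[xs ys] /eqP E]|[h]].
  exists (x - s); last by zmod.
  by rewrite inE xs; apply/eqP; apply: (zeqz 1 E); zmod.
rewrite inE => /andP[hS /eqP E] ->; split.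
  rewrite opprB [x + (h - x)]addrC subrK hS /=.
  by rewrite (_ : y + (h - x) = - h) ?(memN SN) ?hS //; apply: (zeqz 1 E); zmod.
by apply/eqP; apply: (zeqz 1 E); zmod.
Qed.

(** [b] maps the common neighbours of x and y bijectively onto those of a x and a y. *)
Lemma twofold_parity a b x y : twofold (cay S) a b ->
  halves_parity S (a x - a y) = halves_parity S (x - y).
Proof.
move=> [ia ib ab]; rewrite -!common_parity.
rewrite -(card_imset [set v | (x - v \in S) && (y - v \in S)] ib).
congr (odd _); apply: eq_card => v; rewrite -(f_invF ib v) mem_imset // !inE.
by have := ab x (invF ib v); have := ab y (invF ib v); rewrite !cayE => -> ->.
Qed.

(** When doubling is injective, the differences with an odd number of halves in S are exactly the
    doubles of elements of S. *)
Lemma twofold_double a b : (forall s t : G, s + s = t + t -> s = t) ->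
  twofold (cay S) a b ->
  twofold (cay [set s + s | s in S]) a a.
Proof.
move=> dI tf; have [ia _ _] := tf; split=> // x y; rewrite !cayE.
suff mem d : (d \in [set s + s | s in S]) = halves_parity S d.
  by rewrite !mem (twofold_parity _ _ tf).
rewrite /halves_parity; apply/imsetP/idP=> [[s sS ->]|].
  rewrite (_ : [set _ in S | _] = [set s]) ?cards1 //.
  by apply/setP=> t; rewrite !inE; apply/andP/eqP=> [[_ /eqP/dI]|->].
have [-> |[s]] := set_0Vmem [set s in S | s + s == d]; first by rewrite cards0.
by rewrite inE => /andP[sS /eqP <-] _; exists s.
Qed.

End Parity.

(* Some power of two fixes [S] under dilation, and the dilates by powers of two
   are preserved by [twofold_double]. *)
Lemma odd_order_twofold_trivial (G : finZmodType) (S : {set G}) a b :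
  S = [set - s | s in S] -> (forall s t : G, s + s = t + t -> s = t) ->
  #|S| = 4%N -> twofold (cay S) a b -> a =1 b.
Proof.
move=> SN dI S4 tf.
pose D (T : {set G}) : {set G} := [set s + s | s in T].
have DI : injective D by apply: imset_inj => s t; apply: dI.
have DN (T : {set G}) : T = [set - s | s in T] -> D T = [set - s | s in D T].
  by move=> TN; rewrite {1}TN /D -!imset_comp; apply: eq_imset => s /=; rewrite opprD.
have iterP k : (iter k.+1 D S = [set - s | s in iter k.+1 D S]) /\
    twofold (cay (iter k.+1 D S)) a a.
  elim: k => [|k [IHN IHtf]]; first by split; [exact: DN | exact: twofold_double tf].
  by split; [exact: DN IHN | exact: twofold_double IHtf].
(* Doubling permutes the subsets of G, so S returns after [fingraph.order D S] steps; the
   predecessor compensates for [k.+1] in [iterP]. Hence (a, a) is itself two-fold for S. *)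
have [_ tfa] := iterP (fingraph.order D S).-1.
rewrite prednK ?order_gt0 // iter_order // in tfa.
have [ia ib ab] := tf; have [_ _ aa] := tfa.
move=> y; pose d := a y - b y.
(* Comparing (a, a) with (a, b) shows S + d = S. Summing over the four elements of S then gives 4 d
   = 0, so d = 0. *)
have Sd s : (s + d \in S) = (s \in S).
  have [x xE] : exists x, a x = a y + s by exists (invF ia (a y + s)); rewrite f_invF.
  have := aa x y; have := ab x y; rewrite !cayE xE => <-.
  by rewrite /d addrAC subrr add0r => ->; rewrite addrAC addrC.
have : \sum_(s in S) s = \sum_(s in S) s + d *+ 4.
  rewrite -S4 -sumr_const -big_split /= (reindex_inj (addIr d)) /=.
  by apply: eq_bigl => s; rewrite Sd.
move=> E; have d4 : d + d + (d + d) = 0 + 0 + (0 + 0).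
  by apply: (zeqz (-1) E); zmod.
by apply/eqP; rewrite -subr_eq0; apply/eqP; apply: (dI); exact: dI.
Qed.

Ltac zrefute E F :=
  apply: F; first [apply: (zeqz 1 E); zmod | apply: (zeqz (-1) E); zmod].

(** * Connection sets {t, -t, u, u + z} with 2 z = 0 *)

Section ParallelEdges.
Variables (G : finZmodType) (t u z : G).
Let S := [set t; - t; u; u + z].
Hypothesis SN : S = [set - s | s in S].
Hypothesis Suniq : uniq [:: t; - t; u; u + z].
Hypothesis zz : z + z = 0.
Hypothesis t4 : t *+ 4 != 0.
Hypothesis ut3 : [&& u != t *+ 3, u != - t *+ 3, u + z != t *+ 3 & u + z != - t *+ 3].

(** The elements u and u + z have the same double, so their contributions cancel mod 2. *)
Lemma halves_parityE d : halves_parity S d = (t + t == d) (+) (- t - t == d).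
Proof.
rewrite /halves_parity.
have -> : #|[set s in S | s + s == d]| = count (fun s => s + s == d) [:: t; - t; u; u + z].
  rewrite -size_filter -(card_uniqP (filter_uniq _ Suniq)); apply: eq_card => s.
  by rewrite inE mem_filter andbC !inE -!orbA.
have -> : count (fun s => s + s == d) [:: t; - t; u; u + z] =
    ((t + t == d)%R + (- t - t == d)%R + (u + u == d)%R.*2)%N.
  rewrite /= (_ : u + z + (u + z) = u + u) ?addn0 -?addnn ?addnA //.
  by apply: (zeqz 1 zz); zmod.
by rewrite !oddD odd_double addbF !oddb.
Qed.

Lemma halves_parity_pair p q : p \in S -> q \in S -> p != q ->
  halves_parity S (p - q) -> (p = t /\ q = - t) \/ (p = - t /\ q = t).
Proof.
case/and4P: ut3 => /eqP u1 /eqP u2 /eqP u3 /eqP u4; move/eqP: t4 => nt4.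
have := Suniq; rewrite /= !inE !negb_or -!andbA.
case/and5P => _ /eqP tu /eqP tuz /eqP ntu /andP[/eqP ntuz _].
rewrite halves_parityE -!orbA => pS qS pq par.
have {par} par : t + t = p - q \/ - t - t = p - q.
  by move: par; case: eqP => [->|_]; [left | case: eqP => // ->; right].
move: pS qS pq => /or4P[]/eqP-> /or4P[]/eqP-> /eqP pq in par *; case: par => E //;
  try (by left); try (by right); exfalso;
  first [ zrefute E tu | zrefute E tuz | zrefute E ntu | zrefute E ntuz | zrefute E u1
        | zrefute E u2 | zrefute E u3 | zrefute E u4 | apply: nt4;
          first [ apply: (zeqz2 2 1 E zz); zmod | apply: (zeqz2 2 (-1) E zz); zmod
                | apply: (zeqz2 (-2) 1 E zz); zmod
                | apply: (zeqz2 (-2) (-1) E zz); zmod ] ].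
Qed.

(** The points x + t and x - t differ by 2 t, which has odd parity because 4 t is nonzero. Their
    images are neighbours of a x with a difference of odd parity, and only the pair t, -t in S has
    such a difference. *)
Lemma parallel_edge a b x : twofold (cay S) a b ->
  exists2 e, e = t \/ e = - t & b (x + t) = a x + e /\ b (x - t) = a x - e.
Proof.
move=> tf; have [ia ib ab] := tf.
have bS s : s \in S -> b (x + s) - a x \in S.
  by move=> sS; rewrite -(memN SN) opprB -cayE ab cayE opprD addNKr (memN SN).
have tS : t \in S by rewrite !inE eqxx.
have ntS : - t \in S by rewrite !inE eqxx orbT.
have tnt : t != - t by have := Suniq; rewrite /= inE negb_or -andbA => /and3P[].
have pq : b (x + t) - a x != b (x - t) - a x.
  by rewrite (inj_eq (addIr _)) (inj_eq ib) (inj_eq (addrI _)).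
have par : halves_parity S (b (x + t) - a x - (b (x - t) - a x)).
  rewrite (_ : _ - _ - _ = b (x + t) - b (x - t)); last by zmod.
  rewrite (twofold_parity SN _ _ (twofold_sym (cay_sym SN) tf)) halves_parityE.
  have -> : x + t - (x - t) = t + t by zmod.
  rewrite eqxx /=; apply/negP => /eqP E; case/eqP: t4.
  by apply: (zeqz (-1) E); zmod.
have [[E1 E2]|[E1 E2]] := halves_parity_pair (bS _ tS) (bS _ ntS) pq par.
  by exists t; [left|split; [apply: (zeq E1)|apply: (zeq E2)]; zmod].
by exists (- t); [right|split; [apply: (zeq E1)|apply: (zeq E2)]; zmod].
Qed.

(** Both x and x + z are neighbours of x - u, along u and u + z. Since [parallel_edge] accounts for
    the t-edges at x - u, the images of x and x + z use the remaining two directions u and u + z,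
    which differ by z. *)
Lemma parallel_translate a b x : twofold (cay S) a b -> b (x + z) = b x + z.
Proof.
move=> tf; have [ia ib ab] := tf.
have [e et [bt bnt]] := parallel_edge (x - u) tf.
have side s : s \in [:: u; u + z] ->
    b (x - u + s) - a (x - u) = u \/ b (x - u + s) - a (x - u) = u + z.
  rewrite !inE => su.
  have sS : s \in S by rewrite !inE -!orbA su !orbT.
  have : b (x - u + s) - a (x - u) \in S.
    by rewrite -(memN SN) opprB -cayE ab cayE opprD addNKr (memN SN).
  have := Suniq; rewrite /= !inE !negb_or -!andbA => /and5P[_ tu tuz ntu /and3P[ntuz _ _]].
  have st : s != t /\ s != - t.
    by case/orP: su => /eqP->; rewrite eq_sym ?tu ?tuz eq_sym ?ntu ?ntuz.
  have im r : r = t \/ r = - t ->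
      exists2 r', r' = t \/ r' = - t & a (x - u) + r = b (x - u + r').
    case: et => -> in bt bnt; rewrite ?opprK in bnt; case=> ->;
      by [exists t; [left|] | exists (- t); [right|]].
  have ne r : r = t \/ r = - t -> b (x - u + s) - a (x - u) != r.
    case/im => r' r't E; rewrite subr_eq [r + _]addrC E (inj_eq ib) (inj_eq (addrI _)).
    by case: st r't => st1 st2 [] ->.
  have [n1 n2] := (ne t (or_introl erefl), ne (- t) (or_intror erefl)).
  by rewrite -!orbA (negPf n1) (negPf n2) /= => /orP[]/eqP; [left|right].
have uz : u != u + z.
  by have := Suniq; rewrite /= !inE => /and4P[_ _ + _].
have h1 : x - u + u = x by rewrite subrK.
have h2 : x - u + (u + z) = x + z by zmod.
have uS : u \in [:: u; u + z] by rewrite inE eqxx.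
have uzS : u + z \in [:: u; u + z] by rewrite !inE eqxx orbT.
have ne : b (x + z) != b x.
  rewrite (inj_eq ib) -[X in _ == X]addr0 (inj_eq (addrI _)).
  by move: uz; rewrite -{1}[u]addr0 (inj_eq (addrI _)) eq_sym.
move: (side _ uS) (side _ uzS); rewrite h1 h2 => -[] E2 [] E1;
  try by case/eqP: ne; apply: (addIr (- a (x - u))); rewrite E1 E2.
  by apply: (zeqz2 1 (-1) E1 E2); zmod.
rewrite -[b (x + z)](subrK (a (x - u))) -[b x](subrK (a (x - u))) E1 E2.
by apply: (zeqz (-1) zz); zmod.
Qed.

(** Along a line of t-edges the two maps alternate, and the sign of the displacement persists
    because the two t-edges at a vertex have opposite images. Two consecutive positions are carried
    along for the induction. *)
Lemma parallel_walk a b x n : twofold (cay S) a b ->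
  exists2 e, e = t \/ e = - t &
  (if odd n then b else a) (x + t *+ n) = a x + e *+ n /\
  (if odd n then a else b) (x + t *+ n.+1) = a x + e *+ n.+1.
Proof.
move=> tf; have tf' := twofold_sym (cay_sym SN) tf.
have [e et [bt bnt]] := parallel_edge x tf; exists e => //.
elim: n => [|n [IH1 IH2]]; first by rewrite !mulr0n !addr0 !mulr1n.
split; first by rewrite /= if_neg.
set y := x + t *+ n.+1 in IH2.
have -> : x + t *+ n.+2 = y + t by rewrite /y; zmod.
have yt : y - t = x + t *+ n by rewrite /y; zmod.
have {tf tf'} tf2 : twofold (cay S) (if odd n then a else b) (if odd n then b else a).
  by case: odd.
rewrite /= if_neg; have [e' e't []] := parallel_edge y tf2.
rewrite yt IH1 IH2 => -> E.
have -> : e' = e by apply: (zeqz 1 E); rewrite !mulrSr; zmod.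
by rewrite !mulrSr; zmod.
Qed.

(** After an odd number k of steps the walk has passed from [a] to [b]. As k t is 0 or z, its sign
    is immaterial, and a shift by z commutes with [b]. *)
Lemma parallel_twofold_trivial a b k : odd k -> t *+ k = 0 \/ t *+ k = z ->
  twofold (cay S) a b -> a =1 b.
Proof.
move=> ok tk tf x; have [e et [+ _]] := parallel_walk x k tf.
have ek : e *+ k = t *+ k.
  case: et => -> //; rewrite mulNrn; case: tk => ->; first by rewrite oppr0.
  by apply: (zeqz (-1) zz); zmod.
rewrite ok ek; case: tk => ->; first by rewrite !addr0.
by rewrite (parallel_translate x tf) => /addIr.
Qed.
End ParallelEdges.

Lemma spans_ind (G : finZmodType) (S : {set G}) (P : G -> Prop) : spans S ->
  P 0 -> (forall x s, s \in S -> P x -> P (x + s)) -> forall x, P x.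
Proof.
move=> sp P0 PS x; have [w wS ->] := sp x.
elim: w wS => [|s w IHw] /=; first by rewrite big_nil.
by case/andP=> sS /IHw; rewrite big_cons addrC; apply: PS.
Qed.

(* [P i x] is read along walks from 0 to x of length parity i; the odd closed
   walk [w0] makes every x reachable with both parities. *)
Lemma spans_ind2 (G : finZmodType) (S : {set G}) (w0 : seq G) (P : bool -> G -> Prop) :
  spans S -> all (mem S) w0 -> odd (size w0) -> \sum_(s <- w0) s = 0 ->
  P false 0 -> (forall i x s, s \in S -> P i x -> P (~~ i) (x + s)) ->
  forall i x, P i x.
Proof.
move=> sp w0S ow0 sw0 P0 PS.
have walk w : all (mem S) w -> P (odd (size w)) (\sum_(s <- w) s).
  elim: w => [|s w IHw] /=; first by rewrite big_nil.
  by case/andP=> sS /IHw; rewrite big_cons addrC; apply: PS.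
move=> i x; have [w wS E] := sp x.
have [<-|] := eqVneq (odd (size w)) i; first by rewrite E; apply: walk.
move=> ni; have := walk (w ++ w0); rewrite all_cat wS w0S size_cat oddD ow0.
rewrite big_cat /= sw0 addr0 -E => /(_ isT).
by move: ni; case: (odd _) i => [] [].
Qed.

Definition units : seq (int * int) := [:: (1, 0); (-1, 0); (0, 1); (0, -1)].

(** A finite check on quadruples of unit steps in the square grid. The difference of two 2-step
    walks is even of length at most 4, so without short relations the conclusion carries over from
    the grid to G. *)
Lemma units_sum p q r s :
  p \in units -> q \in units -> r \in units -> s \in units ->
  let v := p + q - (r + s) in
  [/\ (`|v.1| + `|v.2| <= 4)%N, ~~ odd (`|v.1| + `|v.2|)%N &
  v = 0 -> [\/ p = r /\ q = s, p = s /\ q = r | q = - p /\ s = - r]].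
Proof.
pose ok p q r s := let v := p + q - (r + s) in
  [&& (`|v.1| + `|v.2| <= 4)%N, ~~ odd (`|v.1| + `|v.2|)%N &
  (v == 0) ==> [|| (p == r) && (q == s), (p == s) && (q == r) | (q == - p) && (s == - r)]].
have check : all (fun p => all (fun q => all (fun r => all (ok p q r) units) units) units) units.
  by vm_compute.
move=> pu qu ru su /=.
have /and3P[-> -> /implyP ok3] := allP (allP (allP (allP check p pu) q qu) r ru) s su.
split=> // /eqP/ok3 /or3P[] /andP[/eqP-> /eqP->];
  by [constructor 1 | constructor 2 | constructor 3].
Qed.

(** * Rigidity without short relations *)

Section Rigid.
Variables (G : finZmodType) (a b : G).
Let S := pm2 a b.

Hypothesis no_short_relation : forall i j : int,
  a *~ i + b *~ j = 0 -> (`|i| + `|j| <= 4)%N -> ~~ odd (`|i| + `|j|) ->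
  i = 0 /\ j = 0.

Lemma pm2N : S = [set - s | s in S].
Proof.
apply/setP=> x; apply/idP/imsetP => [|[y yS ->]].
  by rewrite !inE -!orbA => /or4P[]/eqP->; [exists (- a) | exists a | exists (- b) | exists b];
     rewrite ?opprK // !inE ?eqxx ?orbT.
by move: yS; rewrite !inE -!orbA => /or4P[]/eqP->; rewrite ?opprK ?eqxx ?orbT.
Qed.

Lemma pm2P p :
  reflect (exists2 c, c \in units & p = a *~ c.1 + b *~ c.2) (p \in S).
Proof.
apply: (iffP idP) => [|[c + ->]].
  by rewrite !inE -!orbA => /or4P[]/eqP->;
    [exists (1, 0) | exists (-1, 0) | exists (0, 1) | exists (0, -1)];
    rewrite ?inE ?eqxx ?orbT //=; zmod.
by rewrite !inE => /or4P[]/eqP-> /=;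
  rewrite ?mulr0z ?addr0 ?add0r ?mulrN1z ?mulr1z eqxx ?orbT.
Qed.

Lemma pm2_sum_unique p q r s : p \in S -> q \in S -> r \in S -> s \in S ->
  p + q = r + s -> [\/ p = r /\ q = s, p = s /\ q = r | q = - p /\ s = - r].
Proof.
case/pm2P=> c1 u1 -> /pm2P[c2 u2 ->] /pm2P[c3 u3 ->] /pm2P[c4 u4 ->] E.
have [short ev sums] := units_sum u1 u2 u3 u4.
have [|v1 v2] := no_short_relation _ short ev.
  by apply: (zeqz 1 E) => /=; zmod.
case: sums; first by rewrite [LHS]surjective_pairing v1 v2.
- by move=> [-> ->]; constructor 1.
- by move=> [-> ->]; constructor 2.
by move=> [-> ->]; constructor 3; split => /=; zmod.
Qed.

Lemma pm2_neqN p : p \in S -> p <> - p.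
Proof.
case/pm2P=> c cu -> E.
have [] : c.1 + c.1 = 0 /\ c.2 + c.2 = 0.
  apply: no_short_relation; first by apply: (zeqz 1 E); zmod.
    by move: cu; rewrite !inE => /or4P[]/eqP->.
  by move: cu; rewrite !inE => /or4P[]/eqP->.
by move: cu; rewrite !inE => /or4P[]/eqP->.
Qed.

Lemma pm2_halves_parity p : p \in S -> halves_parity S (p + p).
Proof.
move=> pS; rewrite /halves_parity (_ : [set _ in S | _] = [set p]) ?cards1 //.
apply/setP=> q; rewrite in_set in_set1; apply/andP/eqP => [[qS /eqP E]|->].
  by case: (pm2_sum_unique qS qS pS pS E) => -[] // /pm2_neqN.
by [].
Qed.

(** An r in S with 2 r = p - q gives r + r = p + (- q), and uniqueness of sums leaves only r = p = -
    q, since r = - r is excluded. *)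
Lemma pm2_halves_parity_opp p q : p \in S -> q \in S -> p != q ->
  halves_parity S (p - q) -> q = - p.
Proof.
move=> pS qS pq; rewrite /halves_parity.
have [->|[r]] := set_0Vmem [set s in S | s + s == p - q]; first by rewrite cards0.
rewrite in_set => /andP[rS /eqP E] _.
have nqS : - q \in S by rewrite (memN pm2N).
case: (pm2_sum_unique rS rS pS nqS E) => -[]; last by move/pm2_neqN.
  by move=> <- ->; rewrite opprK.
by move=> E1 <-; rewrite E1 opprK.
Qed.

(** The neighbours x + s and x - s differ by 2 s, whose only half in S is s. Parity is preserved, so
    their images lie opposite each other around f x. *)
Lemma pm2_antipode f g x s : twofold (cay S) f g -> s \in S ->
  g (x - s) - f x = - (g (x + s) - f x).
Proof.
move=> tf sS; have [fI gI fg] := tf.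
have gS r : r \in S -> g (x + r) - f x \in S.
  by move=> rS; rewrite -(memN pm2N) opprB -cayE fg cayE opprD addNKr (memN pm2N).
have nsS : - s \in S by rewrite (memN pm2N).
apply: (pm2_halves_parity_opp (gS _ sS) (gS _ nsS)).
  rewrite (inj_eq (addIr _)) (inj_eq gI) (inj_eq (addrI _)).
  exact/eqP/pm2_neqN.
have -> : g (x + s) - f x - (g (x - s) - f x) = g (x + s) - g (x - s) by zmod.
rewrite (twofold_parity pm2N _ _ (twofold_sym (cay_sym pm2N) tf)).
have -> : x + s - (x - s) = s + s by zmod.
exact: pm2_halves_parity.
Qed.

(* The 4-cycle through [x], [x + s], [x + s + t], [x + t] forces its opposite
   edges to be displaced in the same way. *)
Lemma pm2_square f g x s t : twofold (cay S) f g -> s \in S -> t \in S ->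
  f (x + s + t) - g (x + s) = g (x + t) - f x.
Proof.
move=> tf sS tS; have [fI gI fg] := tf; have tf' := twofold_sym (cay_sym pm2N) tf.
have gS y r : r \in S -> g (y + r) - f y \in S.
  by move=> rS; rewrite -(memN pm2N) opprB -cayE fg cayE opprD addNKr (memN pm2N).
have fS y r : r \in S -> f (y + r) - g y \in S.
  by move=> rS; rewrite -cayE fg cayE addrAC subrr add0r.
have [->|tns] := eqVneq t (- s).
  by rewrite addrK (pm2_antipode _ tf sS) opprB.
have [ts|ts] := eqVneq t s.
  rewrite ts -[LHS]opprK -(pm2_antipode _ tf' sS) addrK; zmod.
have E : g (x + s) - f x + (f (x + s + t) - g (x + s)) =
         g (x + t) - f x + (f (x + t + s) - g (x + t)).
  have -> : x + t + s = x + s + t by rewrite addrAC.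
  zmod.
(* The two ways round the square give equal sums. The first case forces s = t, the second is the
   claim, and the third makes the far corner coincide with x, forcing t = - s. *)
case: (pm2_sum_unique (gS _ _ sS) (fS _ _ tS) (gS _ _ tS) (fS _ _ sS) E) => -[].
- by move/addIr/gI/addrI => st; rewrite st eqxx in ts.
- by [].
move=> E1 _; case/eqP: tns; have /fI E2 : f (x + s + t) = f x.
  by apply: (zeqz 1 E1); zmod.
by apply: (zeqz 1 E2); zmod.
Qed.

Lemma pm2_affine f g : connected (cay S) -> ~ bipartite (cay S) ->
  twofold (cay S) f g -> (exists x, f x != g x) ->
  exists (h : {additive G -> G}) (w : G),
    [/\ injective h, w != 0, w + w = 0 & forall s, s \in S -> h s - w \in S].
Proof.
move=> conn nbip tf [x0 fgx0]; have [fI gI fg] := tf.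
have tf' := twofold_sym (cay_sym pm2N) tf.
have sp := connected_spans pm2N conn.
have [w0 [w0S ow0 sw0]] := odd_relation pm2N sp nbip.
pose walk_ind P := @spans_ind2 _ _ _ P sp w0S ow0 sw0.
(* The displacement of the t-edge at x agrees with that at 0, with [g] and [f] exchanged according
   to the parity of a walk to x. The odd closed walk gives both parities at every x. *)
pose P (i : bool) x := forall t, t \in S ->
  (if i then f (x + t) - g x else g (x + t) - f x) = g t - f 0.
have PP i x : P i x.
  apply: (walk_ind P) => [t _|{}i {}x s sS Px t tS]; first by rewrite add0r.
  rewrite -Px //; case: (i) => /=; first exact: pm2_square tf' sS tS.
  exact: pm2_square tf sS tS.
have Pf x t : t \in S -> f (x + t) = g x + (g t - f 0).
  by move=> tS; rewrite -(PP true x t tS); zmod.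
have Pg x t : t \in S -> g (x + t) = f x + (g t - f 0).
  by move=> tS; rewrite -(PP false x t tS); zmod.
pose w := g 0 - f 0.
(* Each step exchanges the roles of [f] and [g], so g - f changes sign; as every x has both
   parities, w = - w. *)
have Pw i x : g x - f x = if i then - w else w.
  apply: (walk_ind (fun i x => g x - f x = if i then - w else w)) => // {}i {}x s sS E.
  by rewrite Pf // Pg //; case: (i) E => /= E; apply: (zeqz (-1) E); zmod.
have ww : w + w = 0 by have /= E := Pw true 0; apply: (zeqz 1 E); rewrite /w; zmod.
have gE x : g x = f x + w by have /= E := Pw false x; apply: (zeqz 1 E); zmod.
have hS x s : s \in S -> f (x + s) - f 0 = f x - f 0 + (f s - f 0).
  by move=> sS; rewrite (Pf x) // !gE; apply: (zeqz 1 ww); zmod.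
have hD x y : f (x + y) - f 0 = f x - f 0 + (f y - f 0).
  move: y; apply: (spans_ind sp) => [|y s sS IHy]; first by rewrite addr0; zmod.
  by rewrite [x + _]addrA (hS (x + y)) // IHy (hS y) //; zmod.
pose h x := f x - f 0.
have hA : zmod_morphism h.
  move=> x y; have := hD (x - y) y; rewrite subrK => E.
  by apply: (zeqz (-1) E); rewrite /h; zmod.
pose hA' := GRing.isZmodMorphism.Build G G h hA.
exists (HB.pack h hA' : {additive G -> G}), w; split=> //.
- by move=> x y /addIr/fI.
- by apply: contraNneq fgx0 => wz; rewrite gE wz addr0.
move=> s sS /=; have -> : h s - w = g s - f 0.
  by rewrite gE /h; apply: (zeqz (-1) ww); zmod.
by rewrite -[s]add0r -(memN pm2N) opprB -cayE fg cayE opprD addNKr (memN pm2N).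
Qed.
End Rigid.

(** * Two generators of order greater than two *)

Section CyclicMembership.
Variable G : finZmodType.
Implicit Types a b x : G.

Lemma mem_cycle_int b (j : int) : b *~ j \in <[b]>%g.
Proof.
case: j => n; first by rewrite -pmulrn -zmodXgE mem_cycle.
by rewrite NegzE mulrNz -pmulrn -zmodXgE -zmodVgE groupV mem_cycle.
Qed.

Lemma cycle_intP x b : x \in <[b]>%g -> exists j : int, x = b *~ j.
Proof. by case/cycleP=> n ->; exists n%:Z; rewrite zmodXgE pmulrn. Qed.

Lemma mulrz_eq0_order b (j : int) : (b *~ j == 0) = (#[b]%g %| `|j|)%N.
Proof.
rewrite order_dvdn zmodXgE zmod1gE.
by case: j => n //=; rewrite NegzE mulrNz oppr_eq0 -pmulrn.
Qed.

(** The quotient by <[b]> is generated by the coset of a, so its order, the index, is the order of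
    that coset. *)
Lemma index_cycle_dvd a b :
  (forall x, exists i j : int, x = a *~ i + b *~ j) ->
  forall i : int, (a *~ i \in <[b]>%g) = (#|[set: G] : <[b]>|%g %| `|i|)%N.
Proof.
move=> sp i.
have ab A : abelian (A : {set G}) by apply: zmod_abelian.
have nb x : x \in 'N(<[b]>)%g 
  by rewrite (subsetP (sub_abelian_norm (ab [set: G]) (subsetT _))) ?inE.
have quoE : ([set: G] / <[b]>)%g = <[coset <[b]> a]>%g.
  apply/eqP; rewrite eqEsubset; apply/andP; split; last first.
    by rewrite cycle_subG mem_quotient ?inE.
  apply/subsetP=> _ /morphimP[x _ _ ->]; have [j [k ->]] := sp x.
  rewrite -zmodMgE morphM ?nb //= [coset _ (b *~ k)]coset_id ?mem_cycle_int // mulg1.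
  by have /cycleP[n ->] := mem_cycle_int a j; rewrite morphX ?nb // mem_cycle.
rewrite -card_quotient; last by apply/subsetP=> x _; apply: nb.
rewrite quoE -orderE.
have -> : (a *~ i \in <[b]>%g) = (a *+ `|i| \in <[b]>%g).
  by case: i => n //=; rewrite NegzE mulrNz -pmulrn -zmodVgE groupV.
rewrite order_dvdn -morphX ?nb //= -zmodXgE.
by rewrite -{1}[<[b]>%g]ker_coset ker_coset (sameP eqP (kerP _ (nb _))) ker_coset.
Qed.
End CyclicMembership.

Lemma order4 (G : finZmodType) (h : G) : h *+ 2 != 0 -> h *+ 4 = 0 -> #[h]%g = 4%N.
Proof.
move=> h2 h4; have d4 : (#[h]%g %| 4)%N by rewrite order_dvdn zmodXgE h4.
have n2 : ~~ (#[h]%g %| 2)%N by rewrite order_dvdn zmodXgE.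
have := dvdn_leq (erefl : 0 < 4)%N d4; move: n2 d4.
by case: #[h]%g => [|[|[|[|[|]]]]].
Qed.

Section TwoGenerators.
Variable G : finZmodType.
Implicit Types a b w : G.

Lemma pm2_walk a b (s : seq G) : all (mem (pm2 a b)) s ->
  exists i j : int, \sum_(x <- s) x = a *~ i + b *~ j /\ odd `|i + j| = odd (size s).
Proof.
elim: s => [_|x s IHs /= /andP[xS /IHs[i [j [E o]]]]].
  by exists 0, 0; rewrite big_nil; split=> //; zmod.
have [c cu xE] := pm2P _ _ _ xS.
exists (c.1 + i), (c.2 + j); rewrite big_cons /= E xE; split; first by zmod.
by rewrite -o; move: cu; rewrite !inE => /or4P[]/eqP-> /=; lia.
Qed.

Lemma pm2_coords a b : spans (pm2 a b) ->
  forall x, exists i j : int, x = a *~ i + b *~ j.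
Proof.
move=> sp x; have [w /pm2_walk[i [j [E _]]] ->] := sp x.
by exists i, j.
Qed.

Lemma pm2_odd_relation a b : spans (pm2 a b) -> ~ bipartite (cay (pm2 a b)) ->
  exists i j : int, a *~ i + b *~ j = 0 /\ odd `|i + j|.
Proof.
move=> sp nbip; have [w [/pm2_walk[i [j [E o]]] ow sw]] := odd_relation (pm2N a b) sp nbip.
by exists i, j; rewrite o -E.
Qed.

Lemma odd_abszD (i j : int) : odd `|i + j| = odd `|i| (+) odd `|j|.
Proof. by lia. Qed.

Lemma odd_abszM (i j : int) : odd `|i * j| = odd `|i| && odd `|j|.
Proof. by rewrite abszM oddM. Qed.

Lemma int_odd (i : int) : odd `|i| -> exists k : int, i = 2 * k + 1.
Proof. by exists (i %/ 2)%Z; lia. Qed.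

Lemma int_even (i : int) : ~~ odd `|i| -> exists k : int, i = 2 * k.
Proof. by exists (i %/ 2)%Z; lia. Qed.

Lemma involution_odd w (i : int) : w + w = 0 -> odd `|i| -> w *~ i = w.
Proof. by move=> ww /int_odd[k ->]; apply: (zeqz k ww); zmod. Qed.

Lemma involution_even w (i : int) : w + w = 0 -> ~~ odd `|i| -> w *~ i = 0.
Proof. by move=> ww /int_even[k ->]; apply: (zeqz k ww); zmod. Qed.

(** The last hypothesis comes from a map a -> a + w, b -> - b + w, up to sign. On the odd relation
    it gives h = i0 a in both cyclic groups with 2 h = w, so h has order 4. A generator of the
    intersection also gives a relation, and its double is a multiple of w, so its order divides
    4. *)
Lemma family1_intro a b w (i0 j0 : int) : w + w = 0 -> w != 0 ->
  a *~ i0 + b *~ j0 = 0 -> odd `|i0 + j0| ->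
  (forall i j : int, a *~ i + b *~ j = 0 -> a *~ (2 * i) = w *~ (i + j)) ->
  family1 a b.
Proof.
move=> ww w0 rel0 odd0 rel; pose h := a *~ i0.
have hI : h \in (<[a]> :&: <[b]>)%g.
  rewrite inE mem_cycle_int (_ : h = b *~ - j0) ?mem_cycle_int //.
  by apply: (zeqz 1 rel0); rewrite /h; zmod.
have hh : h *+ 2 = w.
  by rewrite -[RHS](involution_odd ww odd0) -rel // /h; zmod.
have oh : #[h]%g = 4%N.
  by apply: order4; rewrite ?hh // -[4%N]/(2 * 2)%N mulrnA hh mulr2n ww.
have /cyclicP[g Ig] : cyclic (<[a]> :&: <[b]>)%g.
  by apply: cyclicS (subsetIl _ _) (cycle_cyclic a).
have gI : g \in (<[a]> :&: <[b]>)%g by rewrite Ig cycle_id.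
rewrite /family1 Ig -orderE; apply/eqP; rewrite eqn_dvd; apply/andP; split.
  case/setIP: gI => /cycle_intP[i gi] /cycle_intP[j gj].
  have E : a *~ i + b *~ (- j) = 0 by apply: (zeqz2 (-1) 1 gi gj); zmod.
  have E2 := rel _ _ E; rewrite order_dvdn zmodXgE zmod1gE gi; apply/eqP.
  by apply: (zeqz2 2 (i - j) E2 ww); zmod.
by move: hI; rewrite Ig -oh => /order_dvdG.
Qed.

(** The hypothesis on relations says that a -> b + w, b -> e a + w respects them. Applying it to
    well-chosen relations yields the numerical conditions one after another. *)
Lemma family2_intro a b w (e i0 j0 : int) :
  (forall x, exists i j : int, x = a *~ i + b *~ j) ->
  e = 1 \/ e = -1 -> w + w = 0 -> w != 0 ->
  a *~ i0 + b *~ j0 = 0 -> odd `|i0| -> ~~ odd `|j0| ->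
  (forall i j : int, a *~ i + b *~ j = 0 ->
     a *~ (e * j) + b *~ i + w *~ (i + j) = 0) ->
  family2 a b.
Proof.
move=> sp e1 ww w0 rel0 oi0 ej0 rel.
have idx := index_cycle_dvd sp; have ord := mulrz_eq0_order b.
set m := #|[set: G] : <[b]>|%g in idx; set n := #[b]%g in ord.
have relm i j : a *~ i + b *~ j = 0 -> (m %| `|i|)%N.
  move=> E; rewrite -idx (_ : a *~ i = b *~ - j) ?mem_cycle_int //.
  by apply: (zeqz 1 E); zmod.
have mi0 := relm _ _ rel0.
have om : odd m by case/dvdnP: mi0 oi0 => c ->; rewrite oddM => /andP[].
(* If m a = y b with y odd, comparison with the odd relation gives an odd multiple of b equal to 0.
   Then n is odd, and y + n is even. *)
have [y [may ey]] : exists y : int, a *~ m = b *~ y /\ ~~ odd `|y|.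
  have : a *~ m \in <[b]>%g by rewrite idx dvdnn.
  case/cycle_intP => y may; have [oy|ey] := boolP (odd `|y|); last by exists y.
  have [c i0c] : exists c : int, i0 = c * m 
    by exists (i0 %/ m)%Z; rewrite divzK // dvdzE.
  have : b *~ (j0 + c * y) == 0.
    by apply/eqP; apply: (zeqz2 1 (- c) rel0 may); rewrite i0c; zmod.
  rewrite ord => /dvdnP[k kE].
  have on : odd n.
    have : odd `|j0 + c * y|.
      move: oi0; rewrite odd_abszD i0c !odd_abszM (negPf ej0) oy andbT.
      by case/andP.
    by rewrite kE oddM => /andP[].
  exists (y + n); split; last by rewrite odd_abszD oy on.
  have /eqP n0 : b *~ n == 0 by rewrite ord.
  by apply: (zeqz2 1 (-1) may n0); zmod.
(* The image of the relation 2 m a - 2 y b = 0 shows that m divides 2 y = 4 y', hence y', because m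
   is odd. *)
have {y may ey} [l may] : exists l : int, a *~ m = b *~ (2 * l * m).
  have [y' yE] := int_even ey; have E : a *~ (2 * m%:Z) + b *~ (- 2 * y) = 0.
    by apply: (zeqz 2 may); zmod.
  have Ew : w *~ (2 * m%:Z + - 2 * y) = 0.
    by apply: involution_even; rewrite // odd_abszD !odd_abszM.
  have : (m %| `|(e * (- 2 * y))%R|)%N.
    apply: (relm _ (2 * m%:Z)); apply: (zeqz2 1 (-1) (rel _ _ E) Ew); zmod.
  have -> : `|(e * (- 2 * y))%R|%N = (4 * `|y'|)%N.
    by rewrite yE; case: e1 => ->; lia.
  rewrite Gauss_dvdr; last by rewrite -[4%N]/(2 ^ 2)%N coprimeXr // coprimen2.
  move=> my'; exists (y' %/ m)%Z; rewrite may yE -[in LHS](@divzK m y') ?dvdzE //.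
  by rewrite mulrA.
have n_gt0 : (0 < n)%N by rewrite order_gt0.
have /eqP n0 : b *~ n == 0 by rewrite ord.
have E0n : a *~ 0 + b *~ n = 0 by rewrite n0 mulr0z addr0.
(* If n were odd, the image of n b = 0 would give n a = w, hence m | 2 n and m | n. Then n a is a
   multiple d b of b, and w = n w = n d b = 0. *)
have en : ~~ odd n.
  apply/negP=> on; have := rel _ _ E0n; rewrite mulr0z addr0 add0r => En.
  have an : a *~ n = w.
    rewrite -(@involution_odd w n ww on); case: e1 En => -> En.
      by apply: (zeqz2 1 (- n%:Z) En ww); zmod.
    by apply: (zeqz (-1) En); zmod.
  have mn : (m %| n)%N.
    have : a *~ (2 * n%:Z) + b *~ 0 = 0 by apply: (zeqz2 2 1 an ww); zmod.
    by move/relm; rewrite abszM /= Gauss_dvdr // coprimen2.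
  have := an; case/dvdnP: mn => c nE.
  have [d ->] : exists d : int, a *~ n = b *~ d.
    by exists (2 * l * m * c); rewrite nE; apply: (zeqz c may); zmod.
  move=> bd; case/eqP: w0; rewrite -(@involution_odd w n ww on) -bd.
  by apply: (zeqz d n0); zmod.
have mn : (m %| n)%N.
  have := rel _ _ E0n; rewrite add0r (@involution_even w n) // addr0.
  by move/relm; rewrite abszM (_ : `|e|%N = 1%N) ?mul1n //; case: e1 => ->.
have [k nE] : exists k, n = (2 * k * m)%N.
  case/dvdnP: mn => c nE; exists c./2.
  have ec : ~~ odd c by move: en; rewrite nE oddM om andbT.
  by rewrite mul2n halfK (negPf ec) subn0.
exists m, k, l; split=> //.
- by rewrite nE !muln_gt0 in n_gt0; case/andP: n_gt0 => /andP[_ ->] ->.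
(* The image of 2 m a - 4 l m b = 0, with m a replaced by 2 l m b, is 2 m (1 - 4 e l^2) b = 0;
   division of the order 2 k m by 2 m leaves the congruence mod k. *)
have E1 : a *~ (2 * m%:Z) + b *~ (- 4 * l * m) = 0 by apply: (zeqz 2 may); zmod.
have Ew : w *~ (2 * m%:Z + - 4 * l * m) = 0.
  by apply: involution_even; rewrite // odd_abszD !odd_abszM.
have : b *~ (2 * m%:Z * (1 - 4 * e * l ^+ 2)) == 0.
  apply/eqP; apply: (zeqz2 1 (4 * e * l) (rel _ _ E1) may).
  by apply: (zeqz (-1) Ew); zmod.
rewrite ord nE abszM abszM /= mulnAC dvdn_pmul2l; last first.
  by rewrite muln_gt0 /= odd_gt0.
have eqm x y : (k %| `|(x - y)%R|)%N -> (x = y %[mod k%:Z])%Z.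
  by move=> kxy; apply/eqP; rewrite eqz_mod_dvd dvdzE.
case: e1 => -> kl; [left | right]; apply: eqm.
  by rewrite -abszN (_ : - _ = 1 - 4 * 1 * l ^+ 2) //; ring.
by rewrite (_ : _ - _ = 1 - 4 * -1 * l ^+ 2) //; ring.
Qed.
End TwoGenerators.

(** * Short relations and the classification for two generators *)

Section TwoGeneratorsUnstable.
Variable G : finZmodType.
Implicit Types a b : G.

Lemma pm2C a b : pm2 a b = pm2 b a.
Proof. by apply/setP=> x; rewrite !inE -!orbA; do 4!case: (x == _). Qed.

Lemma pm2_oppr a b : pm2 a (- b) = pm2 a b.
Proof. by apply/setP=> x; rewrite !inE opprK -!orbA; do 4!case: (x == _). Qed.

Lemma family1C a b : family1 a b -> family1 b a.
Proof. by rewrite /family1 setIC. Qed.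

Lemma pm2_uniqE a b :
  uniq [:: a; - a; b; - b] = [&& a != - a, b != - b, a != b & a != - b].
Proof.
rewrite /= !inE !negb_or !andbT !eqr_oppLR opprK.
by case: (a == - a) (b == - b) (a == b) (a == - b) => [] [] [] [].
Qed.

Lemma double_odd_order4 (y : G) k : odd k -> y *+ (2 * k) = 0 -> y *+ 4 = 0 -> y = - y.
Proof.
move=> ok yk y4; have [q kE] : exists q, k = (2 * q + 1)%N by exists k./2; lia.
by apply: (zeqz2 1 (- q%:Z) yk y4); rewrite kE; zmod.
Qed.

(** In the odd relation, if i is odd then a is a multiple of b, and the intersection is <[a]>, of
    order 4. Otherwise j is odd and j b is 0 or 2 a. The set is then {b, -b, a, a + 2 a}, so the
    parallel-edge argument with t = b and z = 2 a gives f = g. *)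
Lemma order4_twofold a b (i j : int) f g :
  uniq [:: a; - a; b; - b] -> a + a <> b + b -> a *+ 4 = 0 ->
  a *~ i + b *~ j = 0 -> odd `|i + j| ->
  twofold (cay (pm2 a b)) f g -> (exists x, f x != g x) -> family1 a b.
Proof.
rewrite pm2_uniqE => /and4P[aNa bNb ab aNb] a2b2 a4 rel oij tf [x fgx].
have aa4 : a + a + (a + a) = 0 by apply: (zeqz 1 a4); zmod.
have aa0 : a + a != 0 by apply: contraNneq aNa => E; apply/eqP; apply: (zeqz 1 E); zmod.
have [oi|ei] := boolP (odd `|i|).
  have ab' : exists c : int, a = b *~ c.
    have [k iE] := int_odd oi; have [ek|ok] := boolP (odd `|k|).
      by have [l kE] := int_odd ek; exists j; apply: (zeqz2 (-1) (l + 1) rel a4);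
         rewrite iE kE; zmod.
    have [l kE] := int_even ok; exists (- j); apply: (zeqz2 1 (- l) rel a4).
    by rewrite iE kE; zmod.
  have [c aE] := ab'.
  rewrite /family1 (setIidPl _); first by rewrite -orderE order4 // mulr2n.
  by rewrite cycle_subG aE mem_cycle_int.
have oj : odd `|j| by move: oij; rewrite odd_abszD (negPf ei).
pose k := `|j|%N.
have bk : b *+ k = 0 \/ b *+ k = a + a.
  have [i2 iE] := int_even ei.
  have bj : b *~ j = 0 \/ b *~ j = a + a.
    have [oi2|ei2] := boolP (odd `|i2|).
      have [i3 i2E] := int_odd oi2; right; apply: (zeqz2 1 (- i3 - 1) rel a4).
      by rewrite iE i2E; zmod.
    have [i3 i2E] := int_even ei2; left; apply: (zeqz2 1 (- i3) rel a4).
    by rewrite iE i2E; zmod.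
  rewrite /k; case: (j) bj => n //=; rewrite NegzE mulrNz -pmulrn.
  case=> E; [left | right]; first by apply: (zeqz (-1) E); zmod.
  by apply: (zeqz2 (-1) (-1) E aa4); zmod.
have naE : - a = a + (a + a) by apply: (zeqz (-1) a4); zmod.
have SE : pm2 a b = [set b; - b; a; a + (a + a)] by rewrite pm2C /pm2 naE.
have ok : odd k by [].
have b2k : b *+ (2 * k) = 0.
  by case: bk => E; [apply: (zeqz 2 E) | apply: (zeqz2 2 1 E aa4)]; zmod.
have b3 (c : G) : c *+ 4 = 0 -> c != - c -> (c != b *+ 3) && (c != - b *+ 3).
  move=> c4 cNc; apply/andP; split; apply: contraNneq cNc => E; apply/eqP.
    by apply: (double_odd_order4 ok _ c4); rewrite E; apply: (zeqz 3 b2k); zmod.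
  by apply: (double_odd_order4 ok _ c4); rewrite E; apply: (zeqz (-3) b2k); zmod.
have fg1 : f =1 g.
  rewrite SE in tf.
  apply: (@parallel_twofold_trivial _ b a (a + a) _ _ aa4 _ _ f g k) => //.
  - by rewrite -SE; apply: pm2N.
  - by rewrite -naE pm2_uniqE bNb aNa [b == a]eq_sym ab -eqr_oppLR eq_sym.
  - by apply: contraNneq bNb => b4; apply/eqP; apply: (double_odd_order4 ok).
  have /andP[-> ->] := b3 _ a4 aNa.
  rewrite -naE; apply: b3; last by rewrite opprK eq_sym.
  by rewrite mulNrn a4 oppr0.
by rewrite fg1 eqxx in fgx.
Qed.

(** The group is generated by a, and the odd relation becomes (i + 3 j) a = 0 with i + 3 j odd, so
    doubling is injective. *)
Lemma triple_twofold_trivial a b (i j : int) f g :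
  uniq [:: a; - a; b; - b] -> b = a *+ 3 ->
  (forall x, exists i j : int, x = a *~ i + b *~ j) ->
  a *~ i + b *~ j = 0 -> odd `|i + j| ->
  twofold (cay (pm2 a b)) f g -> f =1 g.
Proof.
move=> un bE sp rel oij; apply: odd_order_twofold_trivial.
- exact: pm2N.
- have ok : odd `|i + 3 * j| by move: oij; rewrite !odd_abszD odd_abszM.
  have [k kE] := int_odd ok.
  have cE x : exists c, x = a *~ c.
    by have [p [q ->]] := sp x; exists (p + 3 * q); rewrite bE; zmod.
  have ak : a *~ (2 * k + 1) = 0 by rewrite -kE; apply: (zeqz 1 rel); rewrite bE; zmod.
  move=> s t E; have [c cs] := cE (s - t).
  apply/eqP; rewrite -subr_eq0; apply/eqP.
  have ck : (s - t) *~ (2 * k + 1) = 0 by rewrite cs; apply: (zeqz c ak); zmod.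
  by apply: (zeqz2 1 (- k) ck E); zmod.
have -> : pm2 a b = [set x in [:: a; - a; b; - b]] by apply/setP=> x; rewrite !inE -!orbA.
by rewrite cardsE; apply/card_uniqP.
Qed.

(** Up to sign, the nonzero even relations of length at most 4 are 2a, 2b, a+-b, 2a+-2b, 4a, 4b,
    3a+-b and a+-3b, each excluded by one hypothesis. *)
Lemma no_short_relation_pm2 a b :
  uniq [:: a; - a; b; - b] -> a + a <> b + b -> a + a <> - b - b ->
  a *+ 4 <> 0 -> b *+ 4 <> 0 -> b <> a *+ 3 -> b <> - a *+ 3 ->
  a <> b *+ 3 -> a <> - b *+ 3 ->
  forall i j : int, a *~ i + b *~ j = 0 ->
  (`|i| + `|j| <= 4)%N -> ~~ odd (`|i| + `|j|)%N -> i = 0 /\ j = 0.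
Proof.
rewrite pm2_uniqE => /and4P[/eqP aNa /eqP bNb /eqP ab /eqP aNb].
move=> n1 n2 n3 n4 n5 n6 n7 n8 i j E.
case: i j E => [[|[|[|[|[|i]]]]]|[|[|[|[|i]]]]] [[|[|[|[|[|j]]]]]|[|[|[|[|j]]]]] //= E _ _;
  rewrite ?NegzE in E; exfalso; move: E; rewrite ?mulr0z ?addr0 ?add0r => E;
  first [zrefute E aNa | zrefute E bNb | zrefute E ab | zrefute E aNb
  | zrefute E n1 | zrefute E n2 | zrefute E n3 | zrefute E n4 | zrefute E n5
  | zrefute E n6 | zrefute E n7 | zrefute E n8].
Qed.

Lemma pm2_twofold_family a b f g :
  uniq [:: a; - a; b; - b] -> connected (cay (pm2 a b)) ->
  ~ bipartite (cay (pm2 a b)) ->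
  twofold (cay (pm2 a b)) f g -> (exists x, f x != g x) ->
  [\/ family1 a b, family2 a b \/ family2 b a | family3 a b \/ family3 a (- b)].
Proof.
move=> un conn nbip tf nfg.
have un' := un; rewrite pm2_uniqE in un'; case/and4P: un' => aNa bNb ab aNb.
have sp := connected_spans (pm2N a b) conn; have coords := pm2_coords sp.
have [i0 [j0 [rel0 odd0]]] := pm2_odd_relation sp nbip.
have [a2b2|/eqP a2b2] := eqVneq (a + a) (b + b).
  by constructor 3; left; rewrite /family3 !mulr2n.
have [a2Nb2|/eqP a2Nb2] := eqVneq (a + a) (- b - b).
  by constructor 3; right; rewrite /family3 !mulr2n.
have bNa : b != - a by rewrite -eqr_oppLR eq_sym.
have ba : b != a by rewrite eq_sym.
have Naa : - a != a by rewrite eq_sym.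
have Nbb : - b != b by rewrite eq_sym.
have unC : uniq [:: b; - b; a; - a] by rewrite pm2_uniqE bNb aNa ba bNa.
have relC : b *~ j0 + a *~ i0 = 0 by rewrite addrC.
have oddC : odd `|j0 + i0| by rewrite addrC.
have [a4|/eqP a4] := eqVneq (a *+ 4) 0.
  by constructor 1; apply: (order4_twofold un a2b2 a4 rel0 odd0 tf nfg).
have [b4|/eqP b4] := eqVneq (b *+ 4) 0.
  constructor 1; apply: family1C; rewrite pm2C in tf.
  by apply: (order4_twofold unC _ b4 relC oddC tf nfg) => E; apply: a2b2.
have triv : ~ f =1 g by case: nfg => x /eqP fgx /(_ x).
have unN : uniq [:: a; - a; - b; - - b] by rewrite pm2_uniqE opprK aNa Nbb aNb ab.
have unNC : uniq [:: b; - b; - a; - - a] by rewrite pm2_uniqE opprK bNb Naa bNa ba.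
have [e|/eqP b3a] := eqVneq b (a *+ 3).
  by case: triv; apply: (triple_twofold_trivial un e coords rel0 odd0 tf).
have [e|/eqP a3b] := eqVneq a (b *+ 3).
  case: triv; rewrite pm2C in tf.
  apply: (triple_twofold_trivial unC e _ relC oddC tf) => x.
  by have [i [j ->]] := coords x; exists j, i; rewrite addrC.
have [e|/eqP b3Na] := eqVneq b (- a *+ 3).
  case: triv; rewrite -pm2_oppr in tf.
  apply: (@triple_twofold_trivial a (- b) i0 (- j0) f g unN) => //.
  - by rewrite e mulNrn opprK.
  - by move=> x; have [i [j ->]] := coords x; exists i, (- j); zmod.
  - by apply: (zeqz 1 rel0); zmod.
  by move: odd0; rewrite !odd_abszD abszN.
have [e|/eqP a3Nb] := eqVneq a (- b *+ 3).
  case: triv; rewrite pm2C -pm2_oppr in tf.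
  apply: (@triple_twofold_trivial b (- a) j0 (- i0) f g unNC) => //.
  - by rewrite e mulNrn opprK.
  - by move=> x; have [i [j ->]] := coords x; exists j, (- i); zmod.
  - by apply: (zeqz 1 rel0); zmod.
  by move: odd0; rewrite !odd_abszD abszN addbC.
have nsr := no_short_relation_pm2 un a2b2 a2Nb2 a4 b4 b3a b3Na a3b a3Nb.
have [h [w [hI w0 ww hS]]] := pm2_affine nsr conn nbip tf nfg.
have hE i j : a *~ i + b *~ j = 0 -> h a *~ i + h b *~ j = 0.
  by move=> E; rewrite -!raddfMz -raddfD E raddf0.
have aS : a \in pm2 a b by rewrite !inE eqxx.
have bS : b \in pm2 a b by rewrite !inE eqxx !orbT.
have hab : h a <> h b by move/hI => E; rewrite E eqxx in ab.
have haNb : h a + h b <> 0.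
  rewrite -raddfD -(raddf0 h) => /hI /eqP; rewrite addr_eq0 => /eqP E.
  by rewrite E eqxx in aNb.
have rowE (x c d : G) : x - w \in pm2 c d ->
  exists e : int, (e = 1 \/ e = -1) /\ (x = c *~ e + w \/ x = d *~ e + w).
  rewrite !inE -!orbA => /or4P[]/eqP E.
  - by exists 1; split; [left | left; apply: (zeqz 1 E); zmod].
  - by exists (-1); split; [right | left; apply: (zeqz 1 E); zmod].
  - by exists 1; split; [left | right; apply: (zeqz 1 E); zmod].
  by exists (-1); split; [right | right; apply: (zeqz 1 E); zmod].
have [e1 [e1E]] := rowE _ _ _ (hS a aS); have [e2 [e2E]] := rowE _ _ _ (hS b bS).
(* The images of a and b cannot both come from the same generator, since h is injective and a
   differs from both b and - b. *)
have same c : h a = c *~ e1 + w -> h b = c *~ e2 + w -> False.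
  move=> ha hb; case: e1E e2E ha hb => -> [] -> ha hb.
  - by apply: hab; rewrite ha hb.
  - by apply: haNb; rewrite ha hb; apply: (zeqz 1 ww); zmod.
  - by apply: haNb; rewrite ha hb; apply: (zeqz 1 ww); zmod.
  by apply: hab; rewrite ha hb.
move=> hb ha; case: ha hb => ha [] hb; [by case: (same a) | | | by case: (same b)].
  have w_odd := involution_odd ww odd0.
  have h0 := hE _ _ rel0; rewrite ha hb in h0.
  (* With equal signs, h would turn the odd relation into w (i0 + j0) = 0, that is, w = 0. *)
  have contra : e1 = e2 -> False.
    move=> e12; case/eqP: w0; rewrite -w_odd.
    by apply: (zeqz2 1 (- e1) h0 rel0); rewrite -e12; zmod.
  constructor 1; apply: (family1_intro ww w0 rel0 odd0) => i j E.
  have hij := hE _ _ E; rewrite ha hb in hij.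
  case: e1E e2E hij contra => -> [] -> hij contra; try by case: contra.
    by apply: (zeqz3 1 1 (- (i + j)) E hij ww); zmod.
  by apply: (zeqz3 1 (-1) 0 E hij ww); zmod.
constructor 2.
have ee : e1 * e2 = 1 \/ e1 * e2 = -1.
  by case: e1E e2E => -> [] ->; [left | right | right | left].
(* Exactly one of i0 and j0 is odd; the generator with the odd coefficient plays the part of a in
   family (2). *)
have [oi|ei] := boolP (odd `|i0|).
  left; apply: (family2_intro coords ee ww w0 rel0 oi); first by rewrite odd_abszD oi in odd0.
  move=> i j E; have hij := hE _ _ E; rewrite ha hb in hij.
  case: e1E hij => -> hij; first by apply: (zeqz 1 hij); zmod.
  by apply: (zeqz2 (-1) (i + j) hij ww); zmod.
have oj : odd `|j0| by rewrite odd_abszD (negPf ei) in odd0.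
right; apply: (family2_intro _ ee ww w0 relC oj ei).
  by move=> x; have [i [j ->]] := coords x; exists j, i; rewrite addrC.
move=> i j E; have E' : a *~ j + b *~ i = 0 by rewrite addrC.
have hij := hE _ _ E'; rewrite ha hb in hij.
case: e2E hij => -> hij; first by apply: (zeqz 1 hij); zmod.
by apply: (zeqz2 (-1) (i + j) hij ww); zmod.
Qed.
End TwoGeneratorsUnstable.

(** * Connection sets with involutions *)

Section Involutions.
Variable G : finZmodType.
Implicit Types (a b c d t : G) (S : {set G}).

(** Once a pair t, -t with t != -t is removed, negation either fixes or exchanges the remaining two
    elements. *)
Lemma connection_set_cases S : S = [set - s | s in S] -> #|S| = 4%N ->
  [\/ forall s, s \in S -> s + s = 0,
      exists t b c, [/\ S = [set t; - t; b; c], uniq [:: t; - t; b; c],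
                        b + b = 0 & c + c = 0] |
      exists a b, S = pm2 a b /\ uniq [:: a; - a; b; - b]].
Proof.
move=> SN S4.
have [/existsP[t /andP[tS tNt]]|/existsPn all2] :=
  boolP [exists t, (t \in S) && (t != - t)]; last first.
  constructor 1 => s sS; have := all2 s; rewrite sS negbK => /eqP E.
  by apply: (zeqz 1 E); zmod.
have NtS : - t \in S by rewrite (memN SN).
pose S' := S :\ t :\ - t.
have S'2 : #|S'| = 2%N.
  by have := S4; rewrite (cardsD1 t) tS (cardsD1 (- t)) !inE eq_sym tNt NtS => -[].
have S'N s : s \in S' -> - s \in S'.
  by rewrite !inE (memN SN) eqr_opp eqr_oppLR => /and3P[-> -> ->].
have [b [c [bc S'E]]] : exists b c, b != c /\ S' = [set b; c].
  by have /eqP/cards2P[b [c [bc E]]] := S'2; exists b, c.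
have memS' x : (x \in S :\ t :\ - t) = (x == b) || (x == c).
  by rewrite -/S' S'E !inE.
have SE : S = [set t; - t; b; c].
  apply/setP=> x; have := memS' x; rewrite !inE.
  by case: eqP => [->|]; case: eqP => [->|] //=; rewrite ?tS ?NtS.
have un : uniq [:: t; - t; b; c].
  have := memS' b; have := memS' c; rewrite !inE !eqxx orbT /=.
  move=> /and3P[cNt ct _] /and3P[bNt bt _].
  by rewrite !inE !negb_or tNt bc ![t == _]eq_sym bt ct ![- t == _]eq_sym bNt cNt.
have bS' : b \in S' by rewrite S'E !inE eqxx.
have cS' : c \in S' by rewrite S'E !inE eqxx orbT.
have := S'N _ bS'; rewrite S'E !inE => /orP[] /eqP Nb; last first.
  by constructor 3; exists t, b; rewrite /pm2 Nb.
have bb : b + b = 0 by apply: (zeqz (-1) Nb); zmod.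
have := S'N _ cS'; rewrite S'E !inE => /orP[] /eqP Nc.
  by case/eqP: bc; rewrite -[c]opprK Nc Nb.
constructor 2; exists t, b, c; split=> //.
by apply: (zeqz (-1) Nc); zmod.
Qed.

Lemma bool_mulrn a (x : bool) : a + a = 0 -> a *+ x + a = a *+ ~~ x.
Proof. by case: x; rewrite ?mulr0n ?add0r ?mulr1n. Qed.

Lemma two_involutions_walk t b c (w : seq G) : b + b = 0 -> c + c = 0 ->
  all (mem [set t; - t; b; c]) w ->
  exists (i : int) (j k : bool), \sum_(s <- w) s = t *~ i + b *+ j + c *+ k /\
    odd `|i| (+) j (+) k = odd (size w).
Proof.
move=> bb cc; elim: w => [|s w IHw] /=.
  by exists 0, false, false; rewrite big_nil mulr0z !mulr0n !addr0.
case/andP=> + /IHw[i [j [k [E o]]]]; rewrite big_cons -{}o E !inE -!orbA.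
have o1 : odd `|i + 1| = ~~ odd `|i| by rewrite odd_abszD addbT.
have o2 : odd `|i - 1| = ~~ odd `|i| by rewrite odd_abszD addbT.
case/or4P=> /eqP->.
- by exists (i + 1), j, k; rewrite o1 !addNb; split=> //; zmod.
- by exists (i - 1), j, k; rewrite o2 !addNb; split=> //; zmod.
- exists i, (~~ j), k; rewrite -bool_mulrn // addbN !addNb; split=> //; zmod.
exists i, j, (~~ k); rewrite -[c *+ ~~ k]bool_mulrn // addbN; split=> //; zmod.
Qed.

(** This is the parallel-edge argument with u = b and z = b + c. The condition b != +-3 t holds
    because multiplying by the odd k would put b in {0, b + c}; the same goes for c. *)
Lemma two_involutions_twofold_trivial t b c k f g :
  uniq [:: t; - t; b; c] -> b + b = 0 -> c + c = 0 -> b != 0 -> c != 0 ->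
  odd k -> t *+ k = 0 \/ t *+ k = b + c ->
  twofold (cay [set t; - t; b; c]) f g -> f =1 g.
Proof.
move=> un bb cc b0 c0 ok tk.
have zz : b + c + (b + c) = 0 by apply: (zeqz2 1 1 bb cc); zmod.
have cE : c = b + (b + c) by apply: (zeqz (-1) bb); zmod.
have SN : [set t; - t; b; c] = [set - s | s in [set t; - t; b; c]].
  have Nb : - b = b by apply: (zeqz (-1) bb); zmod.
  have Nc : - c = c by apply: (zeqz (-1) cc); zmod.
  apply/setP=> x; apply/idP/imsetP => [|[y yS ->]].
    by rewrite !inE -!orbA => /or4P[]/eqP->; [exists (- t) | exists t | exists b | exists c];
       rewrite ?opprK // !inE ?eqxx ?orbT.
  by move: yS; rewrite !inE -!orbA => /or4P[]/eqP->; rewrite ?opprK ?Nb ?Nc ?eqxx ?orbT.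
have t2k : t *+ (2 * k) = 0.
  by case: tk => E; [apply: (zeqz 2 E) | apply: (zeqz2 2 1 E zz)]; zmod.
have [q kE] : exists q, k = (2 * q + 1)%N by exists k./2; lia.
have no3 x y : x + x = 0 -> x != 0 -> y + y = 0 -> y != 0 -> x + y = b + c ->
    (x != t *+ 3) && (x != - t *+ 3).
  move=> xx x0 yy y0 xy.
  have xk : x *+ k = x by apply: (zeqz q xx); rewrite kE; zmod.
  have {}tk : t *+ (3 * k) = 0 \/ t *+ (3 * k) = x + y.
    case: tk => E; [left; apply: (zeqz 3 E); zmod | right].
    by rewrite xy; apply: (zeqz2 3 1 E zz); zmod.
  apply/andP; split; apply/eqP=> E.
    have {}E : x = t *+ (3 * k) by rewrite -xk E; zmod.
    case: tk => E'; first by rewrite E E' eqxx in x0.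
    by case/eqP: y0; apply: (zeqz2 (-1) (-1) E E'); zmod.
  have {}E : - x = t *+ (3 * k) by rewrite -xk E; zmod.
  case: tk => E'; first by case/eqP: x0; apply: (zeqz2 (-1) (-1) E E'); zmod.
  by case/eqP: y0; apply: (zeqz3 (-1) (-1) (-1) E E' xx); zmod.
rewrite cE in un SN *.
apply: (parallel_twofold_trivial SN un zz _ _ ok tk).
  have tNt : t != - t by move: un; rewrite /= !inE !negb_or => /andP[/andP[]].
  by apply: contraNneq tNt => t4; apply/eqP; apply: (double_odd_order4 ok).
rewrite -cE; have /andP[-> ->] := no3 b c bb b0 cc c0 erefl.
by apply: (no3 c b) => //; rewrite addrC.
Qed.
End Involutions.

Lemma surj_inj_bij (T U : finType) (f : T -> U) :
  injective f -> (forall y, exists x, y == f x) -> bijective f.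
Proof.
move=> fI fS; pose g y := xchoose (fS y).
have gK : cancel g f by move=> y; apply/esym/eqP; apply: (xchooseP (fS y)).
by exists g => // x; apply: fI; rewrite gK.
Qed.

Lemma modn_Z2n n : (0 < n)%N -> (Zp_trunc (2 * n)).+2 = (2 * n)%N.
Proof. by move=> n_gt0; rewrite Zp_cast //; lia. Qed.

Lemma val_Z2n_nat n k : (0 < n)%N -> (k%:R : 'Z_(2 * n)) = (k %% (2 * n))%N :> nat.
Proof. by move=> n_gt0; rewrite val_Zp_nat //; lia. Qed.

(** * Identification with family (4) *)

Section FamilyFour.
Variables (G : finZmodType) (t c : G) (n : nat).
Hypotheses (n_gt0 : (0 < n)%N) (tn : #[t]%g = (2 * n)%N) (cc : c + c = 0).
Hypothesis ct : c \notin <[t]>%g.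
Hypothesis coords : forall x, exists (i : int) (j : bool), x = t *~ i + c *+ j.

Definition ladder_map (p : ladder_group n) : G := t *+ p.1 + c *+ p.2.

Lemma mulrn_modn (x : G) m k : x *+ m = 0 -> x *+ (k %% m) = x *+ k.
Proof. by move=> xm; rewrite -!zmodXgE expg_mod. Qed.

Lemma ladder_map_additive : nmod_morphism ladder_map.
Proof.
have t0 : t *+ (2 * n) = 0 by rewrite -tn -zmodXgE expg_order.
split=> [|p q]; first by rewrite /ladder_map !mulr0n addr0.
rewrite /ladder_map /= [in X in (_ %% X)%N](modn_Z2n n_gt0) !mulrn_modn //.
by rewrite !mulrnDr addrACA.
Qed.

HB.instance Definition _ := GRing.isNmodMorphism.Build (ladder_group n) G
  ladder_map ladder_map_additive.

Lemma ladder_map_bij : bijective ladder_map.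
Proof.
apply: surj_inj_bij => [|x].
  apply: raddf_inj => -[x y] E; have c0 : c != 0.
    by apply: contraNneq ct => ->; rewrite group1.
  have y0 : y = 0.
    case: y E => -[|[|]] // y2 E; first exact: val_inj.
    case/negP: ct; rewrite (_ : c = t *~ (- x%:Z)) ?mem_cycle_int //.
    have {}E : t *+ x + c = 0 := E.
    by apply: (zeqz 1 E); zmod.
  rewrite y0 in E *; have {}E : t *+ x + c *+ 0 = 0 := E.
  have : (#[t]%g %| x)%N.
    by rewrite order_dvdn zmodXgE; apply/eqP; rewrite mulr0n addr0 in E.
  rewrite tn => /dvdnP[[|k] xE]; first by congr (_, _); apply: val_inj.
  exfalso; have : (x < 2 * n)%N by rewrite -[X in (_ < X)%N](modn_Z2n n_gt0) ltn_ord.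
  by rewrite xE ltnNge mulSn leq_addr.
have [i [j ->]] := coords x.
have /cyclePmin[m ltm ->] := mem_cycle_int t i; rewrite tn in ltm.
exists (inZp m, inZp j) => /=; rewrite /ladder_map /= (modn_Z2n n_gt0) modn_small // zmodXgE.
by case: j.
Qed.

Lemma family4_iso : cay_group_iso [set t; - t; t *+ n; c] (family4_set n).
Proof.
apply: cay_group_iso_sym; exists ladder_map; split; first exact: ladder_map_bij.
have f1 : ladder_map (1, 0) = t by rewrite /ladder_map mulr0n addr0.
have f2 : ladder_map (n%:R, 0) = t *+ n.
  rewrite /ladder_map mulr0n addr0 /= val_Z2n_nat ?modn_small //; lia.
have f3 : ladder_map (0, 1) = c by rewrite /ladder_map mulr0n add0r.
by rewrite /family4_set !imsetU !imset_set1 raddfN /= f1 f2 f3.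
Qed.
End FamilyFour.

(** The cyclic group <[t]> has a single involution, namely b = n t with 2 n the order of t. Hence c
    lies outside it, and t, c give the two factors. *)
Lemma two_involutions_family4 (G : finZmodType) (t b c : G) (i : int) :
  uniq [:: t; - t; b; c] -> b + b = 0 -> c + c = 0 -> b != 0 -> c != 0 ->
  spans [set t; - t; b; c] -> b = t *~ i ->
  exists n, (0 < n)%N /\ cay_group_iso [set t; - t; b; c] (family4_set n).
Proof.
move=> un bb cc b0 c0 sp bi.
have ot x : x != 0 -> x + x = 0 -> x \in <[t]>%g ->
    exists2 n, #[t]%g = (2 * n)%N & x = t *+ n.
  move=> x0 xx /cyclePmin[n ltn xn]; exists n => //.
  rewrite zmodXgE in xn.
  have t2n : t *+ (2 * n) = 0 by apply: (zeqz 1 xx); rewrite xn; zmod.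
  have : (#[t]%g %| 2 * n)%N by rewrite order_dvdn zmodXgE t2n.
  case/dvdnP=> -[|[|q]] qE; last first.
  - by move: ltn; rewrite ltnNge; case/negP; lia.
  - by rewrite qE mul1n.
  by case/eqP: x0; rewrite xn (_ : n = 0%N) //; lia.
have [n tn bn] : exists2 n, #[t]%g = (2 * n)%N & b = t *+ n.
  by apply: ot; rewrite ?bi ?mem_cycle_int // -bi.
have ct : c \notin <[t]>%g.
  apply/negP=> /(ot _ c0 cc)[m tm cm]; move: un; rewrite bn cm.
  have -> : m = n by lia.
  by rewrite /= !inE eqxx !andbF.
have n_gt0 : (0 < n)%N by have := order_gt0 t; rewrite tn; lia.
exists n; split=> //; rewrite bn; apply: family4_iso => // x.
have [w /(two_involutions_walk bb cc)[k [j [l [E _]]]] ->] := sp x.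
by exists (k + (n * j)%N), l; rewrite E bn; zmod.
Qed.

(** In an odd relation i t + j b + k c = 0 with j, k in {0, 1}: if j = k then i is odd, and an odd
    multiple of t is 0 or b + c, which forces f = g. Otherwise b or c is a multiple of t. *)
Lemma two_involutions_family (G : finZmodType) (t b c : G) f g :
  let S := [set t; - t; b; c] in
  S = [set - s | s in S] -> 0 \notin S -> uniq [:: t; - t; b; c] ->
  b + b = 0 -> c + c = 0 -> connected (cay S) -> ~ bipartite (cay S) ->
  twofold (cay S) f g -> (exists x, f x != g x) ->
  exists n, (0 < n)%N /\ cay_group_iso S (family4_set n).
Proof.
move=> S SN S0 un bb cc conn nbip tf [x fgx].
have b0 : b != 0 by apply: contraNneq S0 => <-; rewrite !inE eqxx !orbT.
have c0 : c != 0 by apply: contraNneq S0 => <-; rewrite !inE eqxx !orbT.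
have sp := connected_spans SN conn.
have triv k : odd k -> ~ (t *+ k = 0 \/ t *+ k = b + c).
  move=> ok tk; case/eqP: fgx.
  exact: (two_involutions_twofold_trivial un bb cc b0 c0 ok tk tf).
have [w [/(two_involutions_walk bb cc)[i [j [k [E o]]]] ow sw]] := odd_relation SN sp nbip.
rewrite sw ow in E o.
have SC : [set t; - t; c; b] = S.
  by apply/setP=> y; rewrite !inE -!orbA; do 4!case: (y == _).
case: j k E o => [] [] /= E o.
- have oi : odd `|i| by move: o; case: odd.
  case: (triv _ oi); right; case: (i) E => m /= E.
    by apply: (zeqz3 (-1) (-1) (-1) E bb cc); zmod.
  by apply: (zeqz 1 E); rewrite NegzE; zmod.
- by apply: (@two_involutions_family4 _ t b c (- i)) => //; apply: (zeqz (-1) E); zmod.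
- rewrite -SC; apply: (@two_involutions_family4 _ t c b (- i)) => //.
  + by move: un; rewrite /= !inE !negb_or !andbT [b == c]eq_sym -!andbA; do 6!case: (_ != _).
  + by rewrite SC.
  by apply: (zeqz (-1) E); zmod.
have oi : odd `|i| by move: o; case: odd.
case: (triv _ oi); left; case: (i) E => m /= E.
  by apply: (zeqz (-1) E); zmod.
by apply: (zeqz 1 E); rewrite NegzE; zmod.
Qed.

(** * Connection sets consisting of involutions *)

Section Cube.
Variables (G : finZmodType) (a b d : G).
Hypotheses (aa : a + a = 0) (bb : b + b = 0) (dd : d + d = 0).

Definition cube_map (p : cube_group) : G := a *+ p.1.1 + b *+ p.1.2 + d *+ p.2.

Lemma mulrn_Z2 x (i j : 'Z_2) : x + x = 0 :> G -> x *+ (i + j)%R = x *+ i + x *+ j.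
Proof.
by move=> xx; rewrite -mulrnDr /= mulrn_modn // -zmodXgE expgS expg1.
Qed.

Lemma cube_map_additive : nmod_morphism cube_map.
Proof.
split=> [|p q]; first by rewrite /cube_map !mulr0n !addr0.
rewrite /cube_map [(p + q).1.1]/= [(p + q).1.2]/= [(p + q).2]/= !mulrn_Z2 //; zmod.
Qed.

HB.instance Definition _ := GRing.isNmodMorphism.Build cube_group G
  cube_map cube_map_additive.

Lemma cube_iso : 0 \notin [:: a; b; a + b; d] -> uniq [:: a; b; a + b; d] ->
  (forall x, exists i j k : bool, x = a *+ i + b *+ j + d *+ k) ->
  cay_group_iso [set a; b; a + b; d] family4_cube_set.
Proof.
move=> S0 un coords; apply: cay_group_iso_sym; exists cube_map; split.
  apply: surj_inj_bij => [|x].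
    apply: raddf_inj => -[[x y] z] E.
    have {}E : a *+ x + b *+ y + d *+ z = 0 := E.
    have dE e : d + e = 0 -> e = d by move=> E'; apply: (zeqz2 1 (-1) E' dd); zmod.
    suff : [&& x == 0, y == 0 & z == 0] by case/and3P=> /eqP-> /eqP-> /eqP->.
    move: S0 un E; rewrite /= !inE !negb_or -!andbA ![0 == _]eq_sym => /and4P[a0 b0 ab0 d0].
    case/and5P=> ab _ ad bab /and3P[bd abd _].
    case: x y z => -[|[|]] // x2 [[|[|]] // y2] [[|[|]] // z2] //=;
      rewrite ?mulr0n ?mulr1n ?addr0 ?add0r => /eqP;
      rewrite ?(negPf a0) ?(negPf b0) ?(negPf ab0) ?(negPf d0) //.
    - by rewrite addrC => /eqP/dE E; rewrite E eqxx in bd.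
    - by rewrite addrC => /eqP/dE E; rewrite E eqxx in ad.
    by rewrite addrC => /eqP/dE E; rewrite E eqxx in abd.
  have [i [j [k ->]]] := coords x; exists (inZp i, inZp j, inZp k).
  by rewrite /= /cube_map /=; case: i j k => [] [] [].
have f1 : cube_map (1, 0, 0) = a by rewrite /cube_map !mulr0n !addr0.
have f2 : cube_map (0, 1, 0) = b by rewrite /cube_map !mulr0n addr0 add0r.
have f3 : cube_map (1, 1, 0) = a + b by rewrite /cube_map !mulr0n addr0.
have f4 : cube_map (0, 0, 1) = d by rewrite /cube_map !mulr0n !add0r.
rewrite /family4_cube_set !imsetU !imset_set1.
congr ([set _] :|: [set _] :|: [set _] :|: [set _]);
  [exact: f1 | exact: f2 | exact: f3 | exact: f4].
Qed.
End Cube.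

Section AllInvolutions.
Variable G : finZmodType.
Implicit Types (a b c d : G) (S : {set G}).

Lemma all_involutions_walk a b c d (w : seq G) :
  a + a = 0 -> b + b = 0 -> c + c = 0 -> d + d = 0 ->
  all (mem [set a; b; c; d]) w ->
  exists i j k l : bool, \sum_(s <- w) s = a *+ i + b *+ j + c *+ k + d *+ l /\
    i (+) j (+) k (+) l = odd (size w).
Proof.
move=> aa bb cc dd; elim: w => [|s w IHw] /=.
  by exists false, false, false, false; rewrite big_nil !mulr0n !addr0.
case/andP=> + /IHw[i [j [k [l [E o]]]]]; rewrite big_cons -{}o E !inE -!orbA.
case/or4P=> /eqP->.
- by exists (~~ i), j, k, l; rewrite -bool_mulrn // !addNb; split=> //; zmod.
- by exists i, (~~ j), k, l; rewrite -[b *+ ~~ j]bool_mulrn // addbN !addNb; split=> //; zmod.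
- by exists i, j, (~~ k), l; rewrite -[c *+ ~~ k]bool_mulrn // addbN !addNb; split=> //; zmod.
by exists i, j, k, (~~ l); rewrite -[d *+ ~~ l]bool_mulrn // addbN; split=> //; zmod.
Qed.

Lemma klein_family4 a b c d (S := [set a; b; c; d]) :
  (forall s, s \in S -> s + s = 0) -> 0 \notin S -> uniq [:: a; b; c; d] ->
  spans S -> c = a + b -> cay_group_iso S family4_cube_set.
Proof.
move=> SS S0 un sp cE.
have [aa [bb [cc dd]]] : a + a = 0 /\ b + b = 0 /\ c + c = 0 /\ d + d = 0.
  by do ![split]; apply: SS; rewrite !inE eqxx ?orbT.
rewrite /S cE; apply: cube_iso => // [||x]; rewrite -?cE //.
  by move: S0; rewrite !inE -!orbA.
have [w /(all_involutions_walk aa bb cc dd)[i [j [k [l [E _]]]]] xE] := sp x.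
exists (i (+) k), (j (+) k), l; rewrite xE E cE {xE E}; case: i j k l => [] [] [] [] /=;
  first [zmod | by apply: (zeqz 1 aa); zmod | by apply: (zeqz 1 bb); zmod
        | by apply: (zeqz2 1 1 aa bb); zmod].
Qed.

(** Mod 2, an odd relation is a vanishing sum of one or three elements of S. One is impossible as 0
    is not in S, and three make one element the sum of two others. *)
Lemma all_involutions_family S :
  S = [set - s | s in S] -> 0 \notin S -> #|S| = 4%N ->
  (forall s, s \in S -> s + s = 0) -> connected (cay S) -> ~ bipartite (cay S) ->
  cay_group_iso S family4_cube_set.
Proof.
move=> SN S0 S4 SS conn nbip; have sp := connected_spans SN conn.
have [w [wS ow sw]] := odd_relation SN sp nbip.
have [a [b [c [d [SE un]]]]] : exists a b c d, S = [set a; b; c; d] /\ uniq [:: a; b; c; d].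
  have := enum_uniq S; have : S =i enum S by move=> x; rewrite mem_enum.
  move: S4; rewrite cardE; case: (enum S) => [|a [|b [|c [|d [|]]]]] // _ E un.
  by exists a, b, c, d; split=> //; apply/setP=> x; rewrite E !inE -!orbA.
have [aa [bb [cc dd]]] : a + a = 0 /\ b + b = 0 /\ c + c = 0 /\ d + d = 0.
  by rewrite SE in SS; do ![split]; apply: SS; rewrite !inE eqxx ?orbT.
rewrite SE in wS; have [i [j [k [l [E o]]]]] := all_involutions_walk aa bb cc dd wS.
rewrite sw ow in E o.
have perm4 p q r s : S = [set p; q; r; s] -> uniq [:: p; q; r; s] -> r = p + q ->
    cay_group_iso S family4_cube_set.
  by move=> SE' un' rE; rewrite SE'; apply: klein_family4; rewrite // -SE'.
have n0 x : x \in S -> 0 = x -> cay_group_iso S family4_cube_set.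
  by move=> + E0; rewrite -E0 (negPf S0).
have unP : uniq [:: a; b; d; c] && uniq [:: a; c; d; b] && uniq [:: b; c; d; a].
  move: un; rewrite /= !inE !negb_or !andbT -!andbA.
  rewrite [b == a]eq_sym [c == a]eq_sym [d == a]eq_sym [c == b]eq_sym [d == b]eq_sym [d == c]eq_sym.
  by do 6!case: (_ != _).
case/andP: unP => /andP[un1 un2] un3.
have mS : [&& a \in S, b \in S, c \in S & d \in S] by rewrite SE !inE !eqxx !orbT.
case/and4P: mS => aS bS cS dS.
case: i j k l E o => [] [] [] [] //= E _; rewrite ?mulr0n ?mulr1n ?addr0 ?add0r in E;
  try by [apply: (n0 a) | apply: (n0 b) | apply: (n0 c) | apply: (n0 d)].
- by apply: (perm4 a b c d) => //; apply: (zeqz2 1 1 E cc); zmod.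
- apply: (perm4 a b d c) => //; last by apply: (zeqz2 1 1 E dd); zmod.
  by rewrite SE; apply/setP=> x; rewrite !inE -!orbA; do 4!case: (x == _).
- apply: (perm4 a c d b) => //; last by apply: (zeqz2 1 1 E dd); zmod.
  by rewrite SE; apply/setP=> x; rewrite !inE -!orbA; do 4!case: (x == _).
apply: (perm4 b c d a) => //; last by apply: (zeqz2 1 1 E dd); zmod.
by rewrite SE; apply/setP=> x; rewrite !inE -!orbA; do 4!case: (x == _).
Qed.

End AllInvolutions.

(** * Instability of the families *)

Section FamiliesTwofold.
Variable G : finZmodType.
Implicit Types a b w : G.

(** The map with a -> a' and b -> b' squares to multiplication by e = 1 or -1, so it is
    injective. *)
Lemma pm2_affine_twofold a b w a' b' (e : int) :
  (forall x, exists i j : int, x = a *~ i + b *~ j) ->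
  e = 1 \/ e = -1 -> w != 0 ->
  (forall i j : int, a *~ i + b *~ j = 0 -> a' *~ i + b' *~ j = 0) ->
  (forall f : {additive G -> G}, f a = a' -> f b = b' ->
     f a' = a *~ e /\ f b' = b *~ e) ->
  pm2 a' b' = [set s + w | s in pm2 a b] ->
  nontrivial_twofold (cay (pm2 a b)).
Proof.
move=> coords e1 w0 rel ff shift.
have coords' x : exists ij : int * int, x == a *~ ij.1 + b *~ ij.2.
  by have [i [j ->]] := coords x; exists (i, j).
have [f fE] := extend_additive coords' rel.
have fa : f a = a' by have := fE 1 0; rewrite !mulr1z !mulr0z !addr0.
have fb : f b = b' by have := fE 0 1; rewrite !mulr1z !mulr0z !add0r.
have [fa' fb'] := ff f fa fb.
have ffE x : f (f x) = x *~ e.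
  have [i [j ->]] := coords x; rewrite !raddfD !raddfMz fa fb fa' fb'; zmod.
apply: (@affine_twofold _ _ f w) => //.
  move=> x y E; have := congr1 f E; rewrite !ffE => {}E.
  by case: e1 E => ->; rewrite ?mulr1z ?mulrN1z // => /oppr_inj.
by rewrite -shift /pm2 !imsetU !imset_set1 !raddfN fa fb.
Qed.

Lemma pm2_shift a b w : w + w = 0 ->
  [set s + w | s in pm2 a b] = [set a + w; - a + w; b + w; - b + w].
Proof. by move=> ww; rewrite /pm2 !imsetU !imset_set1. Qed.

(** With g a generator of the intersection and w = 2 g, the map is a -> a + w, b -> - b + w. *)
Lemma family1_twofold a b : spans (pm2 a b) -> ~ bipartite (cay (pm2 a b)) ->
  family1 a b -> nontrivial_twofold (cay (pm2 a b)).
Proof.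
move=> sp nbip fam; have coords := pm2_coords sp.
have [i1 [j1 [rel1 odd1]]] := pm2_odd_relation sp nbip.
have [g Ig] : exists g : G, (<[a]> :&: <[b]>)%g = <[g]>%g.
  by apply/cyclicP; apply: cyclicS (subsetIl _ _) (cycle_cyclic a).
have og : #[g]%g = 4%N by rewrite orderE -Ig.
have /setIP[/cycle_intP[i0 ga] /cycle_intP[j0 gb]] : g \in (<[a]> :&: <[b]>)%g.
  by rewrite Ig cycle_id.
pose w := g + g.
have g4 : g *+ 4 = 0 by rewrite -og -zmodXgE expg_order.
have ww : w + w = 0 by apply: (zeqz 1 g4); rewrite /w; zmod.
have w0 : w != 0.
  apply/negP=> /eqP w0; have : (#[g]%g %| 2)%N by rewrite order_dvdn zmodXgE mulr2n -/w w0.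
  by rewrite og.
have even0 x (i : int) : g \in <[x]>%g -> x *~ i = 0 -> ~~ odd `|i|.
  move=> gx /eqP; rewrite mulrz_eq0_order => xi.
  have /dvdn_trans/(_ xi) : (4 %| #[x]%g)%N by rewrite -og order_dvdG.
  by case/dvdnP=> q ->; rewrite oddM andbF.
have ga' : g \in <[a]>%g by rewrite ga mem_cycle_int.
have gb' : g \in <[b]>%g by rewrite gb mem_cycle_int.
(* For a relation, write i a = c g. Since 4 divides the orders of a and b, i and j agree mod 2 with
   c i0 and c j0. The odd relation then makes i0 + j0 odd, so w (i + j) = w c = 2 i a, as the map
   requires. *)
have par i j : a *~ i + b *~ j = 0 ->
    exists2 c : int, a *~ i = g *~ c & odd `|i + j| = odd `|c| && odd `|i0 + j0|.
  move=> rel; have : a *~ i \in <[g]>%g.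
    rewrite -Ig inE mem_cycle_int (_ : _ *~ _ = b *~ - j) ?mem_cycle_int //.
    by apply: (zeqz 1 rel); zmod.
  case/cycle_intP=> c ic; exists c => //.
  have : ~~ odd `|(i - c * i0)%R|.
    by apply: (even0 a) => //; apply: (zeqz2 1 c ic ga); zmod.
  have : ~~ odd `|(j + c * j0)%R|.
    by apply: (even0 b) => //; apply: (zeqz3 1 (-1) (- c) rel ic gb); zmod.
  rewrite !odd_abszD abszN !odd_abszM.
  by move: (odd `|i|) (odd `|j|) (odd `|c|) (odd `|i0|) (odd `|j0|) => [] [] [] [] [].
have oij : odd `|i0 + j0| by have [c _ E] := par _ _ rel1; move: odd1; rewrite E => /andP[].
apply: (@pm2_affine_twofold a b w (a + w) (- b + w) 1) => //; first by left.
- move=> i j rel; have [c ic E] := par _ _ rel; rewrite oij andbT in E.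
  have gc : g *~ (2 * c) = w *~ c by rewrite /w; zmod.
  have wij : w *~ (i + j) = w *~ c.
    have [oc|ec] := boolP (odd `|c|); first by rewrite !involution_odd // E.
    by rewrite !involution_even // E.
  have {}ic : a *~ (2 * i) = w *~ c by rewrite /w; apply: (zeqz 2 ic); zmod.
  have E1 : a *~ (2 * i) + w *~ (i + j) = 0 by apply: (zeqz3 1 1 c ic wij ww); zmod.
  by apply: (zeqz2 1 (-1) E1 rel); zmod.
- move=> f fa fb; have fw : f w = w.
    rewrite {1}/w ga (_ : _ + _ = a *~ (2 * i0)); last by zmod.
    by rewrite raddfMz fa; apply: (zeqz2 (-2) i0 ga ww); rewrite /w; zmod.
  rewrite raddfD fa fw raddfD raddfN fb fw; split; first by apply: (zeqz 1 ww); zmod.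
  by zmod.
rewrite (pm2_shift _ _ ww) /pm2.
have -> : - (a + w) = - a + w by apply: (zeqz (-1) ww); zmod.
have -> : - (- b + w) = b + w by apply: (zeqz (-1) ww); zmod.
by apply/setP=> x; rewrite !inE -!orbA; do 4!case: (x == _).
Qed.

(** The map is a -> b + w, b -> e a + w, where 4 l^2 = e mod k. *)
Lemma family2_twofold a b : spans (pm2 a b) -> ~ bipartite (cay (pm2 a b)) ->
  family2 a b -> nontrivial_twofold (cay (pm2 a b)).
Proof.
move=> sp nbip [m [k [l [[m_gt0 k_gt0] idx ma ob l2]]]].
have coords := pm2_coords sp.
have [i1 [j1 [rel1 odd1]]] := pm2_odd_relation sp nbip.
have [e [q [e1 kq]]] : exists e q : int, (e = 1 \/ e = -1) /\ 1 - 4 * e * l ^+ 2 = q * k.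
  case: l2 => /eqP; rewrite eqz_mod_dvd => /dvdzP[q E].
    by exists 1, (- q); split; [by left | by rewrite mulNr -E; ring].
  by exists (-1), q; split; [by right | by rewrite -E; ring].
have n0 : b *+ (2 * k * m) = 0 by rewrite -ob -zmodXgE expg_order.
(* All relations are generated by m a = 2 l m b and 2 k m b = 0. *)
have par i j : a *~ i + b *~ j = 0 ->
    exists i' j' : int, i = i' * m /\ j = 2 * k%:Z * m%:Z * j' - 2 * l * m%:Z * i'.
  move=> rel; have : (m %| `|i|)%N.
    rewrite -idx -(index_cycle_dvd coords) (_ : a *~ i = b *~ - j) ?mem_cycle_int //.
    by apply: (zeqz 1 rel); zmod.
  move=> mi; have iE : i = (i %/ m)%Z * m by rewrite divzK // dvdzE.
  set i' := (i %/ m)%Z in iE; exists i'.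
  have : b *~ (2 * l * m%:Z * i' + j) = 0.
    by apply: (zeqz2 1 (- i') rel ma); rewrite iE; zmod.
  move/eqP; rewrite mulrz_eq0_order ob => kmj.
  exists ((2 * l * m%:Z * i' + j) %/ (2 * k * m)%N)%Z; split=> //.
  have := @divzK (2 * k * m)%N (2 * l * m%:Z * i' + j); rewrite dvdzE kmj => /(_ isT).
  by rewrite !PoszM => E; rewrite [_ * (_ %/ _)%Z]mulrC E; ring.
have om : odd m.
  have [i' [j' [iE jE]]] := par _ _ rel1; move: odd1.
  by rewrite iE jE !odd_abszD abszN !odd_abszM /= addbF => /andP[].
(* The image of m a = 2 l m b forces this value, since m is odd and 2 w = 0. It equals q k m b with
   q odd, the involution of <[b]>. *)
pose w := b *~ m - a *~ (2 * e * l * m).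
have wE : w = b *~ (m%:Z * q * k).
  have -> : m%:Z * q * k = m%:Z * (1 - 4 * e * l ^+ 2) by rewrite kq mulrA.
  by rewrite /w; apply: (zeqz (- 2 * e * l) ma); zmod.
have ww : w + w = 0 by rewrite wE; apply: (zeqz q n0); zmod.
have oq : odd `|q|.
  have : odd `|(1 - 4 * e * l ^+ 2)%R| by rewrite odd_abszD abszN !odd_abszM.
  by rewrite kq odd_abszM => /andP[].
have w0 : w != 0.
  rewrite wE mulrz_eq0_order ob !abszM /=.
  have -> : (m * `|q| * k = `|q| * (k * m))%N by rewrite mulnAC mulnC [(m * k)%N]mulnC.
  by rewrite -mulnA dvdn_pmul2r ?muln_gt0 ?k_gt0 // dvdn2 oq.
have woddm : w *~ m = w by apply: involution_odd.
have e2 c : c *~ (e * e) = c :> G by case: e1 => ->; rewrite mulr1z.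
apply: (@pm2_affine_twofold a b w (b + w) (a *~ e + w) e) => //.
- move=> i j rel; have [i' [j' [iE jE]]] := par _ _ rel.
  have wi : w *~ (i + j) = w *~ i'.
    have E : odd `|i + j| = odd `|i'|.
      by rewrite iE jE !odd_abszD abszN !odd_abszM /= om andbT addbF.
    have [oi|ei] := boolP (odd `|i'|); first by rewrite !involution_odd ?E.
    by rewrite !involution_even ?E.
  have : b *~ i + a *~ (e * j) + w *~ i' = 0.
    rewrite iE jE; have n0a : a *~ (2 * k%:Z * m) = 0.
      by apply: (zeqz2 (2 * k%:Z) (2 * l) ma n0); zmod.
    by apply: (zeqz2 (e * j') i' n0a ww); rewrite /w; zmod.
  by move=> E; apply: (zeqz2 1 1 E wi); zmod.
- move=> f fa fb; have fw : f w = w.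
    rewrite {1}/w raddfB !raddfMz /= fa fb.
    by apply: (zeqz3 e 1 (- (e * l * m)) ma woddm ww); zmod.
  split; first by rewrite raddfD fb fw; apply: (zeqz 1 ww); zmod.
  rewrite raddfD raddfMz fa fw; case: e1 => ->; last by zmod.
  by apply: (zeqz 1 ww); zmod.
rewrite (pm2_shift _ _ ww) /pm2.
have -> : - (b + w) = - b + w by apply: (zeqz (-1) ww); zmod.
apply/setP=> x; case: e1 => ->; rewrite ?mulr1z ?mulrN1z.
  have -> : - (a + w) = - a + w by apply: (zeqz (-1) ww); zmod.
  by rewrite !inE -!orbA; do 4!case: (x == _).
have -> : - (- a + w) = a + w by apply: (zeqz (-1) ww); zmod.
by rewrite !inE -!orbA; do 4!case: (x == _).
Qed.

Lemma family3_twofold a b : a != b -> family3 a b ->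
  nontrivial_twofold (cay (pm2 a b)).
Proof.
rewrite /family3 => ab ab2; pose z := b - a.
have zS x : (x - z \in pm2 a b) = (x \in pm2 a b).
  rewrite !inE -!orbA !subr_eq.
  have -> : a + z = b by rewrite /z; zmod.
  have -> : - a + z = - b by rewrite /z; apply: (zeqz (-1) ab2); zmod.
  have -> : b + z = a by rewrite /z; apply: (zeqz (-1) ab2); zmod.
  have -> : - b + z = - a by rewrite /z; zmod.
  by do 4!case: (x == _).
exists id, (fun x => x + z); split; last first.
  exists 0; rewrite add0r eq_sym /z subr_eq add0r eq_sym //.
by split=> // [x y /addIr|x y] //; rewrite !cayE opprD addrA zS.
Qed.
End FamiliesTwofold.

(** * Family (4) as a graph *)

Section FamilyFourGraph.
Variable n : nat.
Hypothesis n_gt0 : (0 < n)%N.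

(** The colour is the parity of the coordinate sum, unaffected by reduction mod 2 n; for odd n the
    generator (n, 0) changes it too. *)
Lemma family4_odd_bipartite : odd n -> bipartite (cay (family4_set n)).
Proof.
move=> on; pose c (p : ladder_group n) := odd p.1 (+) odd p.2.
have odd_modn m k : ~~ odd m -> odd (k %% m) = odd k.
  by move=> em; rewrite {2}(divn_eq k m) oddD oddM (negPf em) andbF.
have cD p q : c (p + q) = c p (+) c q.
  rewrite /c /= [in X in odd (_ %% X)](modn_Z2n n_gt0) !odd_modn ?oddM // !oddD.
  by rewrite addbACA.
have cS s : s \in family4_set n -> c s.
  have c1 : c (1, 0) by [].
  rewrite !inE -!orbA => /or4P[] /eqP-> //.
    by have := cD (1, 0) (- (1, 0)); rewrite subrr c1; case: (c (- _)).
  by rewrite /c /= (val_Z2n_nat _ n_gt0) odd_modn ?oddM // on.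
exists c => x y; rewrite cayE => /cS; have := cD (x - y) y.
by rewrite subrK => -> ->; case: (c y).
Qed.

(** With v = (n, 1), the map p -> p + p.1 v fixes (n, 0) and (0, 1) because n is even, and adds v to
    (1, 0) and its negative. Translation by the involution v exchanges (n, 0) and (0, 1). *)
Lemma family4_even_twofold : ~~ odd n -> nontrivial_twofold (cay (family4_set n)).
Proof.
move=> en; pose v : ladder_group n := (n%:R, 1).
have vv : v + v = 0.
  congr (_, _); last by apply: val_inj.
  rewrite -natrD; apply: val_inj.
  by rewrite /= (val_Z2n_nat _ n_gt0) addnn -mul2n modnn.
have v2n : v *+ (2 * n) = 0 by apply: (zeqz n%:Z vv); zmod.
have vn : v *+ n = 0.
  have /int_even[k kE] : ~~ odd `|n%:Z| by [].
  by rewrite pmulrn kE; apply: (zeqz k vv); zmod.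
pose h (p : ladder_group n) := v *+ p.1.
have hD p q : h (p + q) = h p + h q.
  by rewrite /h /= [in X in (_ %% X)%N](modn_Z2n n_gt0) mulrn_modn // mulrnDr.
have h0 : h 0 = 0 by [].
have hv : h v = 0 by rewrite /h /= (val_Z2n_nat _ n_gt0) modn_small //; lia.
have hvk k : h (v *+ k) = 0 by elim: k => // k IHk; rewrite mulrS hD hv IHk addr0.
pose f p := p + h p.
have fA : nmod_morphism f.
  by split=> [|p q]; rewrite /f ?h0 ?addr0 // hD; zmod.
pose fA' := GRing.isNmodMorphism.Build _ _ f fA.
pose F : {additive ladder_group n -> ladder_group n} := HB.pack f fA'.
have ff p : f (f p) = p.
  have hh : h (h p) = 0 := hvk _.
  by rewrite /f hD hh; apply: (zeqz p.1 vv); rewrite /h; zmod.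
apply: (@affine_twofold _ _ F v); first exact: can_inj ff.
  by rewrite xpair_eqE negb_and oner_eq0 orbT.
rewrite /family4_set !imsetU !imset_set1 raddfN /= /f.
have -> : h (1, 0) = v by [].
have -> : h (n%:R, 0) = 0 by rewrite /h /= (val_Z2n_nat _ n_gt0) modn_small //; lia.
have -> : h (0, 1) = 0 by [].
have e1 : (n%:R, 0) + v = (0, 1) :> ladder_group n.
  by congr (_, _); [exact: (congr1 fst vv) | exact: add0r].
have e2 : (0, 1) + v = (n%:R, 0) :> ladder_group n.
  by rewrite -e1; apply: (zeqz 1 vv); zmod.
rewrite e1 e2 !addr0 opprD (_ : - (1, 0) - v = - (1, 0) + v); last first.
  by apply: (zeqz (-1) vv); zmod.
by apply/setP=> x; rewrite !inE -!orbA; do 4!case: (x == _).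
Qed.

Lemma family4_cay (p q : ladder_group n) : cay (family4_set n) p q =
  (p.1 == q.1) && (p.2 != q.2) || (p.2 == q.2) && (p.1 - q.1 \in [set 1; - 1; n%:R]).
Proof.
case: p q => [x y] [x' y']; rewrite cayE !inE /=.
have Z2 (z z' : 'Z_2) : (z - z' == 1) = (z != z').
  by case: z z' => [[|[|]] // ?] [[|[|]] // ?].
rewrite !xpair_eqE !oppr0 !subr_eq0 Z2.
by rewrite orbC -!orbA -!andb_orl [X in _ || X]andbC.
Qed.

End FamilyFourGraph.

Lemma family4_moebius n : (0 < n)%N ->
  graph_iso (cay (family4_set n)) (cartesian (moebius_ladder n) (complete 2)).
Proof.
move=> n_gt0; exists id; first by exists id.
by move=> p q; rewrite family4_cay /cartesian /moebius_ladder cayE.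
Qed.

Lemma family4_2_cay (p q : ladder_group 2) : cay (family4_set 2) p q =
  (p.1 == q.1) && (p.2 != q.2) || (p.2 == q.2) && (p.1 != q.1).
Proof.
rewrite family4_cay -[p.1 == q.1]subr_eq0.
by congr (_ || _ && _); case: (p.1 - q.1) => [[|[|[|[|]]]] // ?]; rewrite !inE.
Qed.

Lemma family4_complete :
  graph_iso (cay (family4_set 2)) (cartesian (complete 4) (complete 2)).
Proof.
by exists id; [exists id | move=> p q; rewrite family4_2_cay].
Qed.

Lemma family4_cube : graph_iso (cay (family4_set 2)) (cay family4_cube_set).
Proof.
(* Binary digits of the first coordinate. This is no group homomorphism, but in both graphs any two
   distinct first components are adjacent, so a bijection suffices. *)
pose phi (p : ladder_group 2) : cube_group := (inZp p.1, inZp (p.1)./2, p.2).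
pose psi (p : cube_group) : ladder_group 2 := (inZp (p.1.1 + p.1.2.*2), p.2).
have phiK : cancel phi psi.
  by move=> [[[|[|[|[|]]]] // ?] y]; congr (_, _); apply: val_inj.
have psiK : cancel psi phi.
  by move=> [[[[|[|]] // ?] [[|[|]] // ?]] y]; congr (_, _, _); apply: val_inj.
exists phi; first by exists psi.
move=> p q; rewrite family4_2_cay cayE.
have memE (d : cube_group) : (d \in family4_cube_set) =
    (d.1 == 0) && (d.2 != 0) || (d.2 == 0) && (d.1 != 0).
  by case: d => [[[[|[|]] // ?] [[|[|]] // ?]] [[|[|]] // ?]]; rewrite !inE.
have phi1 : ((phi p).1 == (phi q).1) = (p.1 == q.1).
  apply/eqP/eqP => [|E]; last by rewrite /phi /= E.
  case: p q => [x y] [x' y'] /= E.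
  have /(can_inj phiK)[] // : phi (x, 0) = phi (x', 0) by rewrite /phi /= E.
by rewrite memE [(_ - _).1]/= [(_ - _).2]/= !subr_eq0 phi1.
Qed.

(** * Assembling the classification *)

Section Classification.
Variables (G : finZmodType) (S : {set G}).
Hypotheses (SN : S = [set - s | s in S]) (S0 : 0 \notin S).
Hypotheses (conn : connected (cay S)) (S4 : #|S| = 4%N).

Lemma unstable_family : ~ bipartite (cay S) -> nontrivial_twofold (cay S) ->
  [\/ exists a b : G, cay_group_iso S (pm2 a b) /\ family1 a b,
      exists a b : G, cay_group_iso S (pm2 a b) /\ family2 a b,
      exists a b : G, cay_group_iso S (pm2 a b) /\ family3 a b
    | (exists n : nat, (0 < n)%N /\ cay_group_iso S (family4_set n)) \/
      cay_group_iso S family4_cube_set].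
Proof.
move=> nbip [f [g [tf nfg]]].
have iso_refl (T : {set G}) : T = S -> cay_group_iso S T.
  move=> ->; exists (idfun : {additive G -> G}); split; first by exists id.
  exact: imset_id.
have [SS|[t [b [c [SE un bb cc]]]]|[a [b [SE un]]]] := connection_set_cases SN S4.
- by constructor 4; right; apply: (all_involutions_family SN).
- constructor 4; left; have := SN; have := S0; have := conn; have := nbip; have := tf.
  rewrite SE => tf' nbip' conn' S0' SN'.
  exact: (two_involutions_family SN' S0' un bb cc conn' nbip' tf' nfg).
have := (conn, nbip, tf); rewrite {1 2 3}SE => -[[conn' nbip'] tf'].
have [F|[F|F]|[F|F]] := pm2_twofold_family un conn' nbip' tf' nfg.
- by constructor 1; exists a, b; split=> //; apply: iso_refl; rewrite SE.
- by constructor 2; exists a, b; split=> //; apply: iso_refl; rewrite SE.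
- by constructor 2; exists b, a; split=> //; apply: iso_refl; rewrite SE pm2C.
- by constructor 3; exists a, b; split=> //; apply: iso_refl; rewrite SE.
by constructor 3; exists a, (- b); split=> //; apply: iso_refl; rewrite SE pm2_oppr.
Qed.

Lemma family_twofold : ~ bipartite (cay S) ->
  [\/ exists a b : G, cay_group_iso S (pm2 a b) /\ family1 a b,
      exists a b : G, cay_group_iso S (pm2 a b) /\ family2 a b,
      exists a b : G, cay_group_iso S (pm2 a b) /\ family3 a b
    | (exists n : nat, (0 < n)%N /\ cay_group_iso S (family4_set n)) \/
      cay_group_iso S family4_cube_set] ->
  nontrivial_twofold (cay S).
Proof.
move=> nbip; have nbipT (H : finZmodType) (T : {set H}) :
    cay_group_iso S T -> ~ bipartite (cay T).
  by move=> /cay_group_iso_graph iso /(bipartite_iso iso).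
case=> [[a [b [iso F]]]|[a [b [iso F]]]|[a [b [iso F]]]|[[n [n_gt0 iso]]|iso]];
  apply: (nontrivial_twofold_iso (cay_group_iso_graph iso)).
- exact: family1_twofold (cay_group_iso_connected iso SN conn) (nbipT _ _ iso) F.
- exact: family2_twofold (cay_group_iso_connected iso SN conn) (nbipT _ _ iso) F.
- apply: family3_twofold F; have [f [fb fS]] := iso.
  have : #|pm2 a b| = 4%N by rewrite -fS card_imset //; apply: bij_inj.
  move=> c4; apply/eqP=> ab; move: c4; rewrite ab /pm2 -setUA setUid cards2.
  by case: (_ != _).
(* Odd n cannot occur here, since that graph is bipartite. *)
- apply: family4_even_twofold => //; apply/negP=> on.
  exact: nbipT iso (family4_odd_bipartite n_gt0 on).
have [phi [psi phiK psiK] phiE] := family4_cube.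
apply: (@nontrivial_twofold_iso _ _ _ (cay (family4_set 2))).
  exists psi; first by exists phi.
  by move=> x y; rewrite -phiE !psiK.
exact: family4_even_twofold.
Qed.
End Classification.

(** There are finitely many colourings, so the case distinction needs no classical axiom. *)
Lemma bipartite_dec (V : finType) (e : rel V) : bipartite e \/ ~ bipartite e.
Proof.
have [/existsP[c /forallP cP]|/existsPn nc] :=
  boolP [exists c : {ffun V -> bool}, [forall x, forall y, e x y ==> (c x != c y)]].
  by left; exists c => x y; apply/implyP; apply: (forallP (cP x)).
right=> -[c cP]; have /negP[] := nc [ffun x => c x].
by apply/forallP=> x; apply/forallP=> y; apply/implyP; rewrite !ffunE; apply: cP.
Qed.

Theorem theorem3p1 :
  (forall (G : finZmodType) (S : {set G}),
     S = [set - s | s in S] -> 0 \notin S ->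
     connected (cay S) -> regular_of_valency 4 (cay S) ->
     unstable (cay S) <->
       (bipartite (cay S) \/
        [\/ exists a b : G, cay_group_iso S (pm2 a b) /\ family1 a b,
            exists a b : G, cay_group_iso S (pm2 a b) /\ family2 a b,
            exists a b : G, cay_group_iso S (pm2 a b) /\ family3 a b
          | (exists n : nat, (0 < n)%N /\ cay_group_iso S (family4_set n)) \/
            cay_group_iso S family4_cube_set])) /\
  (forall n : nat, (0 < n)%N ->
     graph_iso (cay (family4_set n))
               (cartesian (moebius_ladder n) (complete 2))) /\
  graph_iso (cay (family4_set 2)) (cartesian (complete 4) (complete 2)) /\
  graph_iso (cay (family4_set 2)) (cay family4_cube_set).
Proof.
split; last first.
  by split; [exact: family4_moebius | split; [exact: family4_complete | exact: family4_cube]].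
move=> G S SN S0 conn /(regular_card SN) S4.
have [s sS] : exists s, s \in S by apply/set0Pn; rewrite -card_gt0 S4.
have symS := cay_sym SN.
have [bip|nbip] := bipartite_dec (cay S).
  by split=> [_|_]; [left | apply: (bipartite_unstable sS bip)].
split=> [un|[//|fam]].
  by right; apply: (unstable_family SN S0 conn S4 nbip); apply: unstable_nontrivial_twofold.
by apply: nontrivial_twofold_unstable => //; apply: (family_twofold SN conn S4 nbip fam).
Qed.
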